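(* Let $$\mathfrak{s}_0=\Big\{\mathbf{x}\in\ell_\infty:\sum_{|\mathbf{x}(n)|\geq\epsilon}\frac{1}{n}\text{ converges for each }\epsilon>0\Big\}.$$ Then: (1) $\mathfrak{s}_0$ is a closed ideal in $\ell_\infty$. (2) $\mathfrak{s}_0$ is non-unital. (3) $\mathfrak{s}_0$ contains $\mathfrak{s}_{00}=\{\mathbf{x}\in\ell_\infty:\sum_{\mathbf{x}(n)\neq0}1/n\text{ converges}\}$ densely. (4) $\mathfrak{s}_0$ is isometrically isomorphic (as a normed algebra) to $C_0(Y)$ where $$Y=\bigcup\Big\{\mathrm{cl}_{\beta\mathbb{N}}A:A\subseteq\mathbb{N}\text{ and }\sum_{n\in A}\frac{1}{n}\text{ converges}\Big\}\subseteq\beta\mathbb{N}.$$ In particular, $Y$ is the spectrum of $\mathfrak{s}_0$, is locally compact, non-compact, and contains $\mathbb{N}$ densely. (5) $\mathfrak{s}_0/c_0$ contains an isometric copy of the normed algebra $\bigoplus_{i<2^\omega}\ell_\infty/c_0$.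
   Context: $\mathbb{N}=\{1,2,\ldots\}$ carries the discrete topology, and $\beta\mathbb{N}$ is its Stone–Čech compactification. $\ell_\infty$ is the normed algebra of bounded complex sequences (pointwise operations, supremum norm), and $c_0$ is the ideal of sequences converging to $0$; quotients carry the quotient norm. $C_0(Y)$ is the normed algebra (supremum norm) of continuous bounded $f:Y\to\mathbb{C}$ such that $|f|^{-1}([1/n,\infty))$ is compact for each positive integer $n$. The spectrum is the Gelfand spectrum (of a commutative $C^*$-algebra), identified up to homeomorphism. An algebra is unital if it has a multiplicative identity. For a collection $\{X_i:i\in I\}$ of normed algebras, $\bigoplus_{i\in I}X_i$ is the algebra of all families $(x_i)_{i\in I}$ with $x_i\in X_i$ and $x_i=0$ for all but finitely many $i$, with componentwise operations and the norm $\sup_{i\in I}\|x_i\|_{X_i}$. The index set $\{i<2^\omega\}$ has the cardinality of the continuum. ''Contains an isometric copy'' means that there is a subalgebra isometrically algebra-isomorphic to the given normed algebra. *)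

(* Defs.v *)
From HB Require Import structures.
From mathcomp Require Import all_boot all_order all_algebra.
From mathcomp Require Import all_classical all_reals.
From mathcomp Require Import topology normedtype sequences.
From mathcomp Require Import complex.

Set Implicit Arguments.
Unset Strict Implicit.
Unset Printing Implicit Defensive.

Import Order.TTheory GRing.Theory Num.Theory.
Import numFieldNormedType.Exports.

Local Open Scope classical_set_scope.
Local Open Scope ring_scope.
Local Open Scope complex_scope.

(* Not necessarily unital, commutative or complete. The multiplication is a
   separate operation because the ring structures of the library are unital. *)
HB.mixin Record NormedModule_isNormedAlgebra (K : numDomainType) A
    of NormedModule K A := {
  amul : A -> A -> A;
  amulA : associative amul;
  amulDl : left_distributive amul +%R;
  amulDr : right_distributive amul +%R;
  scale_amull : forall (k : K) (x y : A), k *: amul x y = amul (k *: x) y;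
  scale_amulr : forall (k : K) (x y : A), k *: amul x y = amul x (k *: y);
  norm_amul_le : forall x y : A, `|amul x y| <= `|x| * `|y|
}.

#[short(type="normedAlgType")]
HB.structure Definition NormedAlgebra (K : numDomainType) :=
  {A of NormedModule K A & NormedModule_isNormedAlgebra K A}.

Notation "x ** y" := (amul x y) (at level 40, left associativity) : ring_scope.

Section Algebras.
Variables (K : numDomainType) (A B : normedAlgType K).

Definition unital : Prop := exists e : A, forall x : A, e ** x = x /\ x ** e = x.

Definition subalgebra (S : set A) : Prop :=
  [/\ S 0,
      forall x y, S x -> S y -> S (x + y),
      forall (k : K) x, S x -> S (k *: x) &
      forall x y, S x -> S y -> S (x ** y)].

Definition ideal (I : set A) : Prop :=
  [/\ I 0,
      forall x y, I x -> I y -> I (x + y),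
      forall (k : K) x, I x -> I (k *: x) &
      forall a x, I x -> I (a ** x) /\ I (x ** a)].

Definition closed_ideal (I : set A) : Prop := ideal I /\ closed I.

Lemma ideal_subalgebra I : ideal I -> subalgebra I.
Proof. by case=> I0 ID IZ IM; split=> // x y Ix Iy; have [] := IM x y Iy. Qed.

Definition isometrically_isomorphic : Prop :=
  exists f : A -> B,
    [/\ bijective f,
        forall (k : K) x y, f (k *: x + y) = k *: f x + f y,
        forall x y, f (x ** y) = f x ** f y &
        forall x, `|f x| = `|x|].

End Algebras.

Arguments unital {K} A.
Arguments isometrically_isomorphic {K} A B.

Lemma isometry_continuous (K : numFieldType) (V W : normedModType K)
    (f : V -> W) : (forall x y, `|f x - f y| = `|x - y|) -> continuous f.
Proof.
move=> fI x; apply/cvgrPdist_lt => e e0; apply/nbhs_ballP; exists e => //= y.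
by rewrite -ball_normE/= fI.
Qed.

Section Subalgebra.
Variables (K : numFieldType) (A : normedAlgType K) (S : set A).

Definition subalg_pred of subalgebra S : {pred A} := fun x => `[< S x >].

Variable subS : subalgebra S.

Lemma subalg_pred_submod : submod_closed (subalg_pred subS).
Proof.
have [S0 SD SZ _] := subS; split; first exact/asboolP.
by move=> k x y /asboolP Sx /asboolP Sy; apply/asboolP/SD => //; exact: SZ.
Qed.

HB.instance Definition _ :=
  GRing.isSubmodClosed.Build K A (subalg_pred subS) subalg_pred_submod.

Record subalg : predArgType := Subalg {
  subalg_val :> A;
  _ : subalg_val \in subalg_pred subS }.

HB.instance Definition _ := [isSub for subalg_val].
HB.instance Definition _ := [Choice of subalg by <:].
HB.instance Definition _ := [SubChoice_isSubLmodule of subalg by <:].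

Lemma subalgP (x : subalg) : S x.
Proof. exact/asboolP/(valP x). Qed.

Definition subalg_mul (x y : subalg) : subalg.
Proof.
apply: (@Subalg (subalg_val x ** subalg_val y)); apply/asboolP.
by have [_ _ _] := subS; apply; exact: subalgP.
Defined.

Definition subalg_norm (x : subalg) : K := `|subalg_val x|.

Lemma subalg_normD x y : subalg_norm (x + y) <= subalg_norm x + subalg_norm y.
Proof. exact: ler_normD. Qed.

Lemma subalg_normZ k x : subalg_norm (k *: x) = `|k| * subalg_norm x.
Proof. exact: normrZ. Qed.

Lemma subalg_norm0 x : subalg_norm x = 0 -> x = 0.
Proof. by move=> /normr0_eq0 x0; apply: val_inj. Qed.

HB.instance Definition _ :=
  Lmodule_isNormed.Build K subalg subalg_normD subalg_normZ subalg_norm0.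

Let mulA : associative subalg_mul.
Proof. by move=> x y z; apply: val_inj; exact: amulA. Qed.
Let mulDl : left_distributive subalg_mul +%R.
Proof. by move=> x y z; apply: val_inj; exact: amulDl. Qed.
Let mulDr : right_distributive subalg_mul +%R.
Proof. by move=> x y z; apply: val_inj; exact: amulDr. Qed.
Let mulZl (k : K) x y : k *: subalg_mul x y = subalg_mul (k *: x) y.
Proof. by apply: val_inj; exact: scale_amull. Qed.
Let mulZr (k : K) x y : k *: subalg_mul x y = subalg_mul x (k *: y).
Proof. by apply: val_inj; exact: scale_amulr. Qed.
Let mulN (x y : subalg) : `|subalg_mul x y| <= `|x| * `|y|.
Proof. exact: norm_amul_le. Qed.

HB.instance Definition _ := NormedModule_isNormedAlgebra.Build K subalg
  mulA mulDl mulDr mulZl mulZr mulN.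

Lemma subalg_val_continuous : continuous (subalg_val : subalg -> A).
Proof. exact: isometry_continuous. Qed.

End Subalgebra.

Definition contains_isometric_copy (K : numFieldType) (A B : normedAlgType K) :=
  exists (S : set A) (subS : subalgebra S),
    isometrically_isomorphic B (subalg subS).

Lemma closed_ideal_restrict (K : numFieldType) (A : normedAlgType K)
    (S I : set A) (subS : subalgebra S) :
  closed_ideal I -> closed_ideal [set x : subalg subS | I (subalg_val x)].
Proof.
move=> [[I0 ID IZ IM] Icl]; split.
  split=> //= [x y|k x|a x]; [exact: ID|exact: IZ|exact: IM].
by apply: (preimage_closed _ Icl) => x _; exact: subalg_val_continuous.
Qed.

Section SupInf.
Variable R : realType.
Implicit Types (S : set R[i]) (x y : R[i]).

(* Norms over [R[i]] take their values on the nonnegative real axis of [R[i]]. *)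
Definition csup S : R[i] := (sup [set complex.Re z | z in S])%:C.
Definition cinf S : R[i] := (inf [set complex.Re z | z in S])%:C.

Lemma ge0_ReE x : 0 <= x -> x = (complex.Re x)%:C.
Proof. by move=> /ger0_Im; case: x => a b /= ->. Qed.

Lemma le_Re x y : x <= y -> complex.Re x <= complex.Re y.
Proof. by rewrite lecE => /andP[]. Qed.

Lemma csup_ge0 S : (forall x, S x -> 0 <= x) -> 0 <= csup S.
Proof.
move=> S0; rewrite /csup lecR.
have [->|/set0P[x Sx]] := eqVneq S set0; first by rewrite image_set0 sup0.
have [us|nus] := pselect (has_ubound [set complex.Re z | z in S]); last first.
  by rewrite sup_out// => -[].
apply: (@le_trans _ _ (complex.Re x)); first exact: (le_Re (S0 _ Sx)).
by apply: ub_le_sup => //; exists x.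
Qed.

Lemma csup_ub S (M : R[i]) x : (forall y, S y -> 0 <= y) ->
  (forall y, S y -> y <= M) -> S x -> x <= csup S.
Proof.
move=> S0 SM Sx; rewrite (ge0_ReE (S0 _ Sx)) lecR; apply: ub_le_sup.
  by exists (complex.Re M) => _ [z Sz <-]; exact: le_Re (SM _ Sz).
by exists x.
Qed.

Lemma csup_le S (M : R[i]) : (forall y, S y -> 0 <= y) -> 0 <= M ->
  (forall y, S y -> y <= M) -> csup S <= M.
Proof.
move=> S0 M0 SM; rewrite (ge0_ReE M0) lecR.
have [->|/set0P[x Sx]] := eqVneq S set0.
  by rewrite image_set0 sup0 (le_Re M0).
apply: ge_sup; first by exists (complex.Re x), x.
by move=> _ [z Sz <-]; exact: le_Re (SM _ Sz).
Qed.

Lemma cinf_lb S x : (forall y, S y -> 0 <= y) -> S x -> cinf S <= x.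
Proof.
move=> S0 Sx; rewrite (ge0_ReE (S0 _ Sx)) lecR; apply: ge_inf.
  by exists 0 => _ [z Sz <-]; exact: (le_Re (S0 _ Sz)).
by exists x.
Qed.

Lemma cinf_ge S (M : R[i]) : S !=set0 -> 0 <= M ->
  (forall y, S y -> M <= y) -> M <= cinf S.
Proof.
move=> [x Sx] M0 SM; rewrite (ge0_ReE M0) lecR; apply: lb_le_inf.
  by exists (complex.Re x), x.
by move=> _ [z Sz <-]; exact: le_Re (SM _ Sz).
Qed.

Lemma cinf_ltP S (e : R[i]) : (forall y, S y -> 0 <= y) -> S !=set0 -> 0 < e ->
  exists2 x, S x & x < cinf S + e.
Proof.
move=> S0 [x Sx] e0.
have hS : has_inf [set complex.Re z | z in S].
  split; first by exists (complex.Re x), x.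
  by exists 0 => _ [z Sz <-]; exact: (le_Re (S0 _ Sz)).
have e0' : 0 < complex.Re e by rewrite -ltcR -ge0_ReE// ltW.
have [_ [z Sz <-] ze] := inf_adherent e0' hS.
exists z => //; rewrite (ge0_ReE (S0 _ Sz)) [in ltRHS](ge0_ReE (ltW e0)).
by rewrite -rmorphD ltcR.
Qed.

End SupInf.

Section Quotient.
Variables (R : realType) (A : normedAlgType R[i]) (I : set A).

Definition ideal_pred of closed_ideal I : {pred A} := fun x => `[< I x >].

Variable clI : closed_ideal I.

Lemma ideal_pred_submod : submod_closed (ideal_pred clI).
Proof.
have [[I0 ID IZ _] _] := clI; split; first exact/asboolP.
by move=> k x y /asboolP Ix /asboolP Iy; apply/asboolP/ID => //; exact: IZ.
Qed.

HB.instance Definition _ :=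
  GRing.isSubmodClosed.Build R[i] A (ideal_pred clI) ideal_pred_submod.

Definition quot_alg : Type := Quotient.quot (ideal_pred clI).

HB.instance Definition _ := GRing.Zmodule.on quot_alg.

Definition quot_proj (x : A) : quot_alg :=
  (\pi_(Quotient.quot (ideal_pred clI)) x)%qT.
Definition quot_repr (E : quot_alg) : A := repr E.

Lemma quot_reprK : cancel quot_repr quot_proj.
Proof. exact: reprK. Qed.

Lemma quot_projP x y : quot_proj x = quot_proj y <-> I (x - y).
Proof.
split=> [/eqP|Ixy]; first by rewrite -Quotient.idealrBE => /asboolP.
by apply/eqP; rewrite -Quotient.idealrBE; apply/asboolP.
Qed.

Lemma quot_projD x y : quot_proj (x + y) = quot_proj x + quot_proj y.
Proof. exact: Quotient.pi_add. Qed.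

Lemma quot_proj0 : quot_proj 0 = 0.
Proof. by apply: (addrI (quot_proj 0)); rewrite -quot_projD !addr0. Qed.

Definition quot_scale (k : R[i]) (E : quot_alg) : quot_alg :=
  quot_proj (k *: quot_repr E).

Definition quot_mul (E F : quot_alg) : quot_alg :=
  quot_proj (quot_repr E ** quot_repr F).

Definition quot_norm (E : quot_alg) : R[i] :=
  cinf [set `|x| | x in [set x | quot_proj x = E]].

Lemma quot_scaleE k x : quot_scale k (quot_proj x) = quot_proj (k *: x).
Proof.
have [[_ _ IZ _] _] := clI.
apply/quot_projP; rewrite -scalerBr; apply: IZ.
by apply/quot_projP; rewrite quot_reprK.
Qed.

Lemma amulBl (a b c : A) : (a - b) ** c = a ** c - b ** c.
Proof. by rewrite amulDl -scaleN1r -scale_amull scaleN1r. Qed.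

Lemma amulBr (a b c : A) : c ** (a - b) = c ** a - c ** b.
Proof. by rewrite amulDr -scaleN1r -scale_amulr scaleN1r. Qed.

Lemma quot_mulE x y : quot_mul (quot_proj x) (quot_proj y) = quot_proj (x ** y).
Proof.
have [[_ ID _ IM] _] := clI.
set x' := quot_repr (quot_proj x); set y' := quot_repr (quot_proj y).
have Ix : I (x' - x) by apply/quot_projP; rewrite quot_reprK.
have Iy : I (y' - y) by apply/quot_projP; rewrite quot_reprK.
apply/quot_projP; rewrite -/x' -/y'.
have -> : x' ** y' - x ** y = (x' - x) ** y' + x ** (y' - y).
  by rewrite amulBl amulBr addrA subrK.
by apply: ID; [exact: (IM _ _ Ix).2|exact: (IM _ _ Iy).1].
Qed.

Let scaleA k l E : quot_scale k (quot_scale l E) = quot_scale (k * l) E.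
Proof. by rewrite -[E]quot_reprK !quot_scaleE scalerA. Qed.
Let scale1 : left_id 1 quot_scale.
Proof. by move=> E; rewrite -[E]quot_reprK !quot_scaleE scale1r. Qed.
Let scaleDr : right_distributive quot_scale +%R.
Proof.
move=> k E F; rewrite -[E]quot_reprK -[F]quot_reprK.
by rewrite -quot_projD !quot_scaleE scalerDr quot_projD.
Qed.
Let scaleDl E : {morph quot_scale^~ E : k l / k + l}.
Proof. by move=> k l; rewrite -[E]quot_reprK !quot_scaleE scalerDl quot_projD. Qed.

HB.instance Definition _ := GRing.Zmodule_isLmodule.Build R[i] quot_alg
  scaleA scale1 scaleDr scaleDl.

Lemma quot_projZ (k : R[i]) x : quot_proj (k *: x) = k *: quot_proj x.
Proof. by rewrite -quot_scaleE. Qed.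

Let norm_set E := [set `|x| | x in [set x | quot_proj x = E]].

Let norm_set_ge0 E y : norm_set E y -> 0 <= y.
Proof. by move=> [x _ <-]. Qed.

Let norm_set_neq0 E : norm_set E !=set0.
Proof. by exists `|quot_repr E|, (quot_repr E) => //=; rewrite quot_reprK. Qed.

Lemma quot_norm_le x : quot_norm (quot_proj x) <= `|x|.
Proof. by apply: cinf_lb; [by move=> _ [z _ <-]|exists x]. Qed.

Lemma quot_norm_lt E (e : R[i]) : 0 < e ->
  exists2 x, quot_proj x = E & `|x| < quot_norm E + e.
Proof.
move=> e0; have [_ [x xE <-] xe] :=
  cinf_ltP (@norm_set_ge0 E) (norm_set_neq0 E) e0.
by exists x.
Qed.

Lemma quot_norm_ge0 E : 0 <= quot_norm E.
Proof. by apply: cinf_ge => [|//|_ [z _ <-]//]; exact: norm_set_neq0. Qed.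

Let normD E F : quot_norm (E + F) <= quot_norm E + quot_norm F.
Proof.
apply/ler_addgt0Pr => e e0.
have e2 : 0 < e / 2 by rewrite divr_gt0.
have [x xE xe] := quot_norm_lt E e2; have [y yF ye] := quot_norm_lt F e2.
rewrite -xE -yF -quot_projD; apply: (le_trans (quot_norm_le _)).
apply: (le_trans (ler_normD _ _)); rewrite [e]splitr addrACA.
by rewrite xE yF lerD// ltW.
Qed.

Let normZ_le (k : R[i]) E : quot_norm (k *: E) <= `|k| * quot_norm E.
Proof.
apply/ler_addgt0Pr => e e0.
have k1 : 0 < `|k| + 1 by rewrite ltr_wpDl.
have [x xE xe] := quot_norm_lt E (divr_gt0 e0 k1).
rewrite -{1}xE -quot_projZ; apply: (le_trans (quot_norm_le _)).
rewrite normrZ (le_trans (ler_wpM2l (normr_ge0 k) (ltW xe)))//.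
rewrite mulrDr lerD2l mulrCA -{2}[e]mulr1 ler_wpM2l ?(ltW e0)//.
by rewrite ler_pdivrMr// mul1r lerDl.
Qed.

Let normZ (k : R[i]) E : quot_norm (k *: E) = `|k| * quot_norm E.
Proof.
apply/le_anti/andP; split; first exact: normZ_le.
have [->|k0] := eqVneq k 0; first by rewrite normr0 mul0r quot_norm_ge0.
have nk0 : 0 < `|k| by rewrite normr_gt0.
rewrite -ler_pdivlMl// -normfV.
have {1}-> : E = k^-1 *: (k *: E) by rewrite scalerA mulVf// scale1r.
exact: normZ_le.
Qed.

Let norm0 E : quot_norm E = 0 -> E = 0.
Proof.
have [[_ _ IZ _] Icl] := clI.
move=> E0; rewrite -[E]quot_reprK -quot_proj0; apply/quot_projP; rewrite subr0.
apply: Icl => U /nbhs_ballP[e /= e0 eU].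
have [x xE] := quot_norm_lt E e0; rewrite E0 add0r => xe.
exists (quot_repr E - x); split.
  by apply/quot_projP; rewrite quot_reprK xE.
by apply: eU; rewrite -ball_normE/= opprB addrC subrK.
Qed.

HB.instance Definition _ := Lmodule_isNormed.Build R[i] quot_alg normD normZ norm0.

Let mulA : associative quot_mul.
Proof.
move=> x y z; rewrite -[x]quot_reprK -[y]quot_reprK -[z]quot_reprK.
by rewrite !quot_mulE amulA.
Qed.
Let mulDl : left_distributive quot_mul +%R.
Proof.
move=> x y z; rewrite -[x]quot_reprK -[y]quot_reprK -[z]quot_reprK.
by rewrite -quot_projD !quot_mulE amulDl quot_projD.
Qed.
Let mulDr : right_distributive quot_mul +%R.
Proof.
move=> x y z; rewrite -[x]quot_reprK -[y]quot_reprK -[z]quot_reprK.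
by rewrite -quot_projD !quot_mulE amulDr quot_projD.
Qed.
Let mulZl (k : R[i]) x y : k *: quot_mul x y = quot_mul (k *: x) y.
Proof.
rewrite -[x]quot_reprK -[y]quot_reprK.
by rewrite -quot_projZ !quot_mulE -quot_projZ scale_amull.
Qed.
Let mulZr (k : R[i]) x y : k *: quot_mul x y = quot_mul x (k *: y).
Proof.
rewrite -[x]quot_reprK -[y]quot_reprK.
by rewrite -quot_projZ !quot_mulE -quot_projZ scale_amulr.
Qed.
Let mulN (E F : quot_alg) : `|quot_mul E F| <= `|E| * `|F|.
Proof.
have ub (e : R[i]) : 0 < e ->
    `|quot_mul E F| <= (`|E| + e) * (`|F| + e).
  move=> e0; have [x xE xe] := quot_norm_lt E e0.
  have [y yF ye] := quot_norm_lt F e0.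
  rewrite -{1}xE -{1}yF quot_mulE; apply: (le_trans (quot_norm_le _)).
  by apply: (le_trans (norm_amul_le _ _)); apply: ler_pM => //; exact: ltW.
apply/ler_addgt0Pr => d d0.
set M := `|E| + `|F| + 1.
have M0 : 0 < M by rewrite ltr_wpDl// addr_ge0.
pose e := d / (d + M).
have e0 : 0 < e by rewrite divr_gt0// addr_gt0.
apply: (le_trans (ub _ e0)).
have dM : 0 < d + M by rewrite addr_gt0.
have e1 : e <= 1 by rewrite (ler_pdivrMr _ _ dM) mul1r lerDl ltW.
rewrite mulrDl !mulrDr [`|E| * e]mulrC -addrA lerD2l addrA -!mulrDr.
apply: (@le_trans _ _ (e * M)); first by rewrite ler_wpM2l ?lerD2l// ltW.
by rewrite /e mulrAC (ler_pdivrMr _ _ dM) ler_pM2l// lerDr ltW.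
Qed.

HB.instance Definition _ := NormedModule_isNormedAlgebra.Build R[i] quot_alg
  mulA mulDl mulDr mulZl mulZr mulN.

End Quotient.

Section BoundedFunctions.
Variables (R : realType) (T : Type).

Definition bfun_pred : {pred T -> R[i]^o} := fun f => `[< bounded_fun f >].

Lemma bounded_funP (f : T -> R[i]^o) :
  bounded_fun f <-> exists2 M : R[i], 0 <= M & forall t, `|f t| <= M.
Proof.
split=> [[M [Mr fM]]|[M M0 fM]].
  exists (`|M| + 1) => [|t]; first by rewrite addr_ge0.
  by apply: (fM (`|M| + 1)) => //; rewrite ltr_pwDr// real_ler_norm.
exists M; split; first exact: ger0_real.
by move=> N /ltW MN t _; exact: le_trans (fM t) MN.
Qed.

Lemma bfun_pred_submod : submod_closed bfun_pred.
Proof.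
split; first by apply/asboolP/bounded_funP; exists 0 => // t; rewrite normr0.
move=> k f g /asboolP/bounded_funP[M M0 fM] /asboolP/bounded_funP[N N0 gN].
apply/asboolP/bounded_funP; exists (`|k| * M + N) => [|t].
  by rewrite addr_ge0// mulr_ge0.
rewrite (le_trans (ler_normD _ _))// lerD//.
by rewrite normrM ler_wpM2l.
Qed.

HB.instance Definition _ :=
  GRing.isSubmodClosed.Build R[i] (T -> R[i]^o) bfun_pred bfun_pred_submod.

Record bfun : predArgType := BFun {
  bfun_fun :> T -> R[i]^o;
  _ : bfun_fun \in bfun_pred }.

HB.instance Definition _ := [isSub for bfun_fun].
HB.instance Definition _ := [Choice of bfun by <:].
HB.instance Definition _ := [SubChoice_isSubLmodule of bfun by <:].

Lemma bfunP (f : bfun) : exists2 M : R[i], 0 <= M & forall t, `|f t| <= M.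
Proof. exact/bounded_funP/asboolP/(valP f). Qed.

Definition bfun_norm (f : bfun) : R[i] := csup (range (fun t => `|f t|)).

Lemma bfun_norm_ub (f : bfun) t : `|f t| <= bfun_norm f.
Proof.
have [M M0 fM] := bfunP f.
by apply: (@csup_ub _ _ M) => [_ [? _ <-]//|_ [s _ <-]//|]; exists t.
Qed.

Lemma bfun_norm_le (f : bfun) M :
  0 <= M -> (forall t, `|f t| <= M) -> bfun_norm f <= M.
Proof. by move=> M0 fM; apply: csup_le => // _ [t _ <-]. Qed.

Lemma bfun_norm_ge0 (f : bfun) : 0 <= bfun_norm f.
Proof. by apply: csup_ge0 => _ [t _ <-]. Qed.

Let normD (f g : bfun) : bfun_norm (f + g) <= bfun_norm f + bfun_norm g.
Proof.
apply: bfun_norm_le => [|t]; first by rewrite addr_ge0// bfun_norm_ge0.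
by rewrite (le_trans (ler_normD _ _))// lerD// bfun_norm_ub.
Qed.

Let normZ_le (k : R[i]) (f : bfun) : bfun_norm (k *: f) <= `|k| * bfun_norm f.
Proof.
apply: bfun_norm_le => [|t]; first by rewrite mulr_ge0// bfun_norm_ge0.
by rewrite [leLHS]normrM ler_wpM2l// bfun_norm_ub.
Qed.

Let normZ (k : R[i]) (f : bfun) : bfun_norm (k *: f) = `|k| * bfun_norm f.
Proof.
apply/le_anti/andP; split; first exact: normZ_le.
have [->|k0] := eqVneq k 0; first by rewrite normr0 mul0r bfun_norm_ge0.
have nk0 : 0 < `|k| by rewrite normr_gt0.
rewrite -ler_pdivlMl// -normfV.
have {1}-> : f = k^-1 *: (k *: f) by rewrite scalerA mulVf// scale1r.
exact: normZ_le.
Qed.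

Let norm0 (f : bfun) : bfun_norm f = 0 -> f = 0.
Proof.
move=> f0; apply: val_inj; apply/funext => t; apply/eqP.
by rewrite -normr_le0 -f0 bfun_norm_ub.
Qed.

HB.instance Definition _ := Lmodule_isNormed.Build R[i] bfun normD normZ norm0.

Definition bfun_mul (f g : bfun) : bfun.
Proof.
apply: (@BFun (fun t => f t * g t)); apply/asboolP/bounded_funP.
have [M M0 fM] := bfunP f; have [N N0 gN] := bfunP g.
by exists (M * N) => [|t]; rewrite ?mulr_ge0// normrM ler_pM.
Defined.

Let mulA : associative bfun_mul.
Proof. by move=> f g h; apply/val_inj/funext => t; exact: mulrA. Qed.
Let mulDl : left_distributive bfun_mul +%R.
Proof. by move=> f g h; apply/val_inj/funext => t; exact: mulrDl. Qed.
Let mulDr : right_distributive bfun_mul +%R.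
Proof. by move=> f g h; apply/val_inj/funext => t; exact: mulrDr. Qed.
Let mulZl (k : R[i]) f g : k *: bfun_mul f g = bfun_mul (k *: f) g.
Proof. by apply/val_inj/funext => t; exact: mulrA. Qed.
Let mulZr (k : R[i]) f g : k *: bfun_mul f g = bfun_mul f (k *: g).
Proof. by apply/val_inj/funext => t; exact: mulrCA. Qed.
Let mulN (f g : bfun) : `|bfun_mul f g| <= `|f| * `|g|.
Proof.
apply: bfun_norm_le => [|t]; first exact: mulr_ge0.
by rewrite [leLHS]normrM; apply: ler_pM => //; exact: bfun_norm_ub.
Qed.

HB.instance Definition _ := NormedModule_isNormedAlgebra.Build R[i] bfun
  mulA mulDl mulDr mulZl mulZr mulN.

End BoundedFunctions.

Section DirectSum.
Variables (R : realType) (I : Type) (X : I -> normedAlgType R[i]).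

Definition families : Type := forall i, X i.

HB.instance Definition _ := Choice.on families.

Let add (x y : families) : families := fun i => x i + y i.
Let opp (x : families) : families := fun i => - x i.
Let scale (k : R[i]) (x : families) : families := fun i => k *: x i.
Let addA : associative add.
Proof. by move=> x y z; apply: functional_extensionality_dep => i; exact: addrA. Qed.
Let addC : commutative add.
Proof. by move=> x y; apply: functional_extensionality_dep => i; exact: addrC. Qed.
Let add0 : left_id (fun=> 0) add.
Proof. by move=> x; apply: functional_extensionality_dep => i; exact: add0r. Qed.
Let addN : left_inverse (fun=> 0) opp add.
Proof. by move=> x; apply: functional_extensionality_dep => i; exact: addNr. Qed.

HB.instance Definition _ := GRing.isZmodule.Build families addA addC add0 addN.

Let scaleA k l x : scale k (scale l x) = scale (k * l) x.
Proof. by apply: functional_extensionality_dep => i; exact: scalerA. Qed.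
Let scale1 : left_id 1 scale.
Proof. by move=> x; apply: functional_extensionality_dep => i; exact: scale1r. Qed.
Let scaleDr : right_distributive scale +%R.
Proof. by move=> k x y; apply: functional_extensionality_dep => i; exact: scalerDr. Qed.
Let scaleDl x : {morph scale^~ x : k l / k + l}.
Proof. by move=> k l; apply: functional_extensionality_dep => i; exact: scalerDl. Qed.

HB.instance Definition _ := GRing.Zmodule_isLmodule.Build R[i] families
  scaleA scale1 scaleDr scaleDl.

Definition dsum_pred : {pred families} :=
  fun x => `[< finite_set [set i | x i <> 0] >].

Lemma dsum_pred_submod : submod_closed dsum_pred.
Proof.
split; first by apply/asboolP; apply: (sub_finite_set _ (finite_set0 I)) => i.
move=> k x y /asboolP fx /asboolP fy; apply/asboolP.
apply: (@sub_finite_set _ _ ([set i | x i <> 0] `|` [set i | y i <> 0])).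
  move=> i /= kxy; apply: contrapT => /not_orP[/contrapT x0 /contrapT y0].
  by apply: kxy; rewrite /GRing.add/= /GRing.scale/= /add /scale x0 y0 scaler0 addr0.
by rewrite finite_setU.
Qed.

HB.instance Definition _ :=
  GRing.isSubmodClosed.Build R[i] families dsum_pred dsum_pred_submod.

Record dsum : predArgType := DSum {
  dsum_fam : families;
  _ : dsum_fam \in dsum_pred }.

HB.instance Definition _ := [isSub for dsum_fam].
HB.instance Definition _ := [Choice of dsum by <:].
HB.instance Definition _ := [SubChoice_isSubLmodule of dsum by <:].

Definition dsum_coord (x : dsum) (i : I) : X i := dsum_fam x i.
Coercion dsum_coord : dsum >-> Funclass.

Lemma dsumP (x : dsum) : finite_set [set i | x i <> 0].
Proof. exact/asboolP/(valP x). Qed.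

Lemma dsum_bounded (x : dsum) : exists2 M : R[i], 0 <= M & forall i, `|x i| <= M.
Proof.
have /finite_seqP[s sE] : finite_set [set `|x i| | i in [set i | x i <> 0]].
  exact: finite_image (dsumP x).
exists (\sum_(z <- s) `|z|); first by rewrite sumr_ge0.
move=> i; have [x0|x0] := pselect (x i = 0).
  by rewrite x0 normr0 sumr_ge0.
have : `|x i| \in s by have : [set` s] `|x i| by rewrite -sE; exists i.
by move=> xs; rewrite (big_rem _ xs)/= normr_id lerDl sumr_ge0.
Qed.

Definition dsum_norm (x : dsum) : R[i] := csup (range (fun i => `|x i|)).

Lemma dsum_norm_ub (x : dsum) i : `|x i| <= dsum_norm x.
Proof.
have [M M0 xM] := dsum_bounded x.
by apply: (@csup_ub _ _ M) => [_ [? _ <-]//|_ [s _ <-]//|]; exists i.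
Qed.

Lemma dsum_norm_le (x : dsum) M :
  0 <= M -> (forall i, `|x i| <= M) -> dsum_norm x <= M.
Proof. by move=> M0 xM; apply: csup_le => // _ [i _ <-]. Qed.

Lemma dsum_norm_ge0 (x : dsum) : 0 <= dsum_norm x.
Proof. by apply: csup_ge0 => _ [i _ <-]. Qed.

Let normD (x y : dsum) : dsum_norm (x + y) <= dsum_norm x + dsum_norm y.
Proof.
apply: dsum_norm_le => [|i]; first by rewrite addr_ge0// dsum_norm_ge0.
by rewrite (le_trans (ler_normD _ _))// lerD// dsum_norm_ub.
Qed.

Let normZ_le (k : R[i]) (x : dsum) : dsum_norm (k *: x) <= `|k| * dsum_norm x.
Proof.
apply: dsum_norm_le => [|i]; first by rewrite mulr_ge0// dsum_norm_ge0.
by rewrite [leLHS]normrZ ler_wpM2l// dsum_norm_ub.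
Qed.

Let normZ (k : R[i]) (x : dsum) : dsum_norm (k *: x) = `|k| * dsum_norm x.
Proof.
apply/le_anti/andP; split; first exact: normZ_le.
have [->|k0] := eqVneq k 0; first by rewrite normr0 mul0r dsum_norm_ge0.
have nk0 : 0 < `|k| by rewrite normr_gt0.
rewrite -ler_pdivlMl// -normfV.
have {1}-> : x = k^-1 *: (k *: x) by rewrite scalerA mulVf// scale1r.
exact: normZ_le.
Qed.

Let norm0 (x : dsum) : dsum_norm x = 0 -> x = 0.
Proof.
move=> x0; apply: val_inj; apply: functional_extensionality_dep => i.
by apply/eqP; rewrite -normr_le0 -x0 dsum_norm_ub.
Qed.

HB.instance Definition _ := Lmodule_isNormed.Build R[i] dsum normD normZ norm0.

Definition dsum_mul (x y : dsum) : dsum.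
Proof.
apply: (@DSum (fun i => x i ** y i)); apply/asboolP.
apply: sub_finite_set (dsumP x) => i /= xy x0; apply: xy.
by rewrite x0 -[0 in LHS](scale0r (0 : X i)) -scale_amull scale0r.
Defined.

Let mulA : associative dsum_mul.
Proof.
by move=> x y z; apply/val_inj/functional_extensionality_dep => i; exact: amulA.
Qed.
Let mulDl : left_distributive dsum_mul +%R.
Proof.
by move=> x y z; apply/val_inj/functional_extensionality_dep => i; exact: amulDl.
Qed.
Let mulDr : right_distributive dsum_mul +%R.
Proof.
by move=> x y z; apply/val_inj/functional_extensionality_dep => i; exact: amulDr.
Qed.
Let mulZl (k : R[i]) x y : k *: dsum_mul x y = dsum_mul (k *: x) y.
Proof.
by apply/val_inj/functional_extensionality_dep => i; exact: scale_amull.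
Qed.
Let mulZr (k : R[i]) x y : k *: dsum_mul x y = dsum_mul x (k *: y).
Proof.
by apply/val_inj/functional_extensionality_dep => i; exact: scale_amulr.
Qed.
Let mulN (x y : dsum) : `|dsum_mul x y| <= `|x| * `|y|.
Proof.
apply: dsum_norm_le => [|i]; first exact: mulr_ge0.
rewrite (le_trans (norm_amul_le _ _))//.
by apply: ler_pM => //; exact: dsum_norm_ub.
Qed.

HB.instance Definition _ := NormedModule_isNormedAlgebra.Build R[i] dsum
  mulA mulDl mulDr mulZl mulZr mulN.

End DirectSum.

Section VanishingAtInfinity.
Variables (R : realType) (T : topologicalType).

Definition C0_set : set (bfun R T) :=
  [set f | continuous (f : T -> R[i]^o) /\
           forall n, (0 < n)%N -> compact [set t | n%:R^-1 <= `|f t|]].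

Lemma norm_ge_closed (f : bfun R T) (e : R[i]) :
  continuous (f : T -> R[i]^o) -> 0 < e -> closed [set t | e <= `|f t|].
Proof.
move=> cf e0.
have -> : [set t | e <= `|f t|] =
    (f : T -> R[i]^o) @^-1` (~` ball (0 : R[i]^o) e).
  apply/seteqP; split=> t /=; rewrite -ball_normE/= sub0r normrN.
    by move=> ef; apply/negP; rewrite -real_leNgt// ger0_real// ltW.
  by move/negP; rewrite -real_leNgt// ger0_real// ltW.
apply: preimage_closed => [t _|]; first exact: cf.
by apply: open_closedC; exact: ball_open.
Qed.

Lemma C0_compact (f : bfun R T) (e : R[i]) : C0_set f -> 0 < e ->
  compact [set t | e <= `|f t|].
Proof.
move=> [cf kf] e0.
have er : 0 < complex.Re e by rewrite -ltcR -ge0_ReE// ltW.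
have [n ne] : exists n, n.+1%:R^-1 <= e.
  have [n /ltW] := ltr_add_invr er; rewrite add0r => ne.
  exists n; rewrite [leRHS](ge0_ReE (ltW e0)) -(rmorph_nat (real_complex R)).
  by rewrite -fmorphV lecR.
apply: (subclosed_compact _ (kf n.+1 isT)).
  exact: norm_ge_closed.
by move=> t /=; exact: le_trans.
Qed.

Lemma C0_subalgebra : subalgebra C0_set.
Proof.
have inv0 n : (0 < n)%N -> 0 < n%:R^-1 :> R[i] by rewrite invr_gt0 ltr0n.
have sub (f : bfun R T) (c : R[i]) (K : set T) :
    continuous (f : T -> R[i]^o) -> 0 < c -> compact K ->
    [set t | c <= `|f t|] `<=` K -> compact [set t | c <= `|f t|].
  by move=> cf c0 cK; apply: subclosed_compact => //; exact: norm_ge_closed.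
split.
- have c_cst : continuous ((0 : bfun R T) : T -> R[i]^o).
    exact: cst_continuous.
  split=> // n n0; apply: (sub _ _ _ c_cst (inv0 _ n0) compact0) => t /=.
  by rewrite normr0 => /(lt_le_trans (inv0 _ n0)); rewrite ltxx.
- move=> f g Cf Cg.
  have cfg : continuous ((f + g : bfun R T) : T -> R[i]^o).
    move=> t; have h := @cvgD _ _ _ _ _ f g _ _ (Cf.1 t) (Cg.1 t); exact: h.
  split=> // n n0; have n2 : 0 < n%:R^-1 / 2 :> R[i] by rewrite divr_gt0// inv0.
  apply: (sub _ _ _ cfg (inv0 _ n0)
    (compactU (C0_compact Cf n2) (C0_compact Cg n2))) => t /= nfg.
  apply: contrapT => /not_orP[/negP nf /negP ng]; move: nfg; apply/negP.
  rewrite -!real_ltNge ?ger0_real// ?ltW ?inv0// in nf ng *.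
  by rewrite (le_lt_trans (ler_normD _ _))// [ltRHS]splitr ltrD.
- move=> k f Cf.
  have ckf : continuous ((k *: f : bfun R T) : T -> R[i]^o).
    move=> t; have h := @cvgZl_tmp _ _ _ _ _ k f _ (Cf.1 t); exact: h.
  split=> // n n0; have k1 : 0 < `|k| + 1 by rewrite ltr_wpDl.
  have nk : 0 < n%:R^-1 / (`|k| + 1) by rewrite divr_gt0// inv0.
  apply: (sub _ _ _ ckf (inv0 _ n0) (C0_compact Cf nk)) => t /= nkf.
  rewrite ler_pdivrMr// mulrC (le_trans nkf)// [leLHS]normrM.
  by rewrite ler_wpM2r// lerDl.
- move=> f g Cf Cg.
  have cfg : continuous (bfun_mul f g : T -> R[i]^o).
    by move=> t; apply: continuousM; [exact: Cf.1|exact: Cg.1].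
  split=> // n n0; have [M M0 gM] := bfunP g.
  have M1 : 0 < M + 1 by rewrite ltr_wpDl.
  have nM : 0 < n%:R^-1 / (M + 1) by rewrite divr_gt0// inv0.
  apply: (sub _ _ _ cfg (inv0 _ n0) (C0_compact Cf nM)) => t /= nfg.
  rewrite ler_pdivrMr// (le_trans nfg)// normrM.
  by rewrite ler_wpM2l// (le_trans (gM t))// lerDl.
Qed.

Definition C0 := subalg C0_subalgebra.

End VanishingAtInfinity.

(* The index [n : nat] stands for the positive integer [n.+1]; accordingly,
   [harmonic n] is [n.+1%:R^-1]. *)
Notation linfty R := (bfun R nat).

Section Sequences.
Variable R : realType.

Local Notation linfty := (linfty R).

Definition c0 : set linfty :=
  [set x | (x : nat -> R[i]^o) @ \oo --> (0 : R[i]^o)].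

Definition reciprocal_summable (A : set nat) : Prop :=
  cvgn (series (fun n => if n \in A then harmonic n else 0 : R)).

Definition s0 : set linfty :=
  [set x | forall eps : R, 0 < eps ->
    reciprocal_summable [set n | eps%:C <= `|x n|]].

Definition s00 : set linfty :=
  [set x | reciprocal_summable [set n | x n != 0]].

Lemma c0P (x : linfty) : c0 x <->
  forall e : R[i], 0 < e -> \forall n \near \oo, `|x n| < e.
Proof. by split=> [/cvgr0Pnorm_lt|?]; last exact/cvgr0Pnorm_lt. Qed.

Lemma c0_closed_ideal : closed_ideal c0.
Proof.
split; last first.
  move=> x clx; apply/c0P => e e0.
  have e2 : 0 < e / 2 by rewrite divr_gt0.
  have [y [/c0P/(_ _ e2) cy]] := clx _ (nbhsx_ballx x _ e2).
  rewrite -ball_normE/= => xy; near=> n.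
  rewrite -[x n](subrK (y n)) (le_lt_trans (ler_normD _ _))// [ltRHS]splitr.
  apply: ltrD; last by near: n.
  exact: le_lt_trans (bfun_norm_ub (x - y) n) xy.
have mul (f g : linfty) : c0 g -> c0 (bfun_mul f g).
  move=> /c0P cg; apply/c0P => e e0; have [M M0 fM] := bfunP f.
  have M1 : 0 < M + 1 by rewrite ltr_wpDl.
  have [N _ Ng] := cg _ (divr_gt0 e0 M1); exists N => // n /Ng /= {}Ng.
  rewrite normrM; move: Ng; rewrite ltr_pdivlMr//; apply: le_lt_trans.
  by rewrite mulrC ler_wpM2l// (le_trans (fM n))// lerDl.
split.
- by apply/c0P => e e0; near=> n; rewrite normr0.
- by move=> f g cf cg; rewrite /c0/= -[0](addr0 (0 : R[i]^o)); exact: cvgD.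
- move=> k f /c0P cf; apply/c0P => e e0.
  have k1 : 0 < `|k| + 1 by rewrite ltr_wpDl.
  have [N _ Nf] := cf _ (divr_gt0 e0 k1); exists N => // n /Nf /= {}Nf.
  rewrite [ltLHS]normrM; move: Nf; rewrite ltr_pdivlMr//; apply: le_lt_trans.
  by rewrite mulrC ler_wpM2l// lerDl.
- move=> f g cg; split; first exact: mul.
  suff -> : g ** f = bfun_mul f g by exact: mul.
  by apply/val_inj/funext => n; exact: mulrC.
Unshelve. all: by end_near. Qed.

End Sequences.

Definition homeomorphic (T U : topologicalType) : Prop :=
  exists (f : T -> U) (g : U -> T),
    [/\ cancel f g, cancel g f, continuous f & continuous g].

Definition topological_embedding (T U : topologicalType) (f : T -> U) : Prop :=
  [/\ injective f, continuous f &
      forall O, open O -> exists2 V, open V & f @^-1` V = O].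

Definition stone_cech (X B : topologicalType) (e : X -> B) : Prop :=
  [/\ compact [set: B], hausdorff_space B,
      topological_embedding e, dense (range e) &
      forall (K : topologicalType) (f : X -> K),
        compact [set: K] -> hausdorff_space K -> continuous f ->
        exists2 g : B -> K, continuous g & g \o e = f].

(* The characters of [A], with the topology of pointwise convergence on [A]. *)
Definition spectrum (R : realType) (A : normedAlgType R[i]) :
    set {ptws A -> R[i]^o} :=
  [set chi | [/\ exists x, chi x <> 0,
                 forall (k : R[i]) x y, chi (k *: x + y) = k * chi x + chi y &
                 forall x y, chi (x ** y) = chi x * chi y]].
Arguments spectrum {R} A.

Definition reciprocal_summable_closure (R : realType) (B : topologicalType)
    (e : nat -> B) : set B :=
  \bigcup_(A in reciprocal_summable R) closure (e @` A).

(* Main.v *)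
(* Both [s0] and [Y] are governed by the ideal of reciprocal-summable subsets of
   [nat]. For such a set [A] the closure of [e @` A] is compact and open in [B],
   and [Y] is the directed union of these closures, so a compact subset of [Y]
   lies in a single one of them; hence continuous extension to [B] followed by
   restriction to [Y] maps [s0] isometrically onto [C0 Y].

   A character [phi] of [s0] takes the value 1 at the indicator of some summable
   [A]. The sets [S] with [phi 1_{e^-1(S) & A} = 1] form a proper filter on [B];
   at a cluster point [p] of it every [x] satisfies [phi x = extend x p], since
   [phi] cannot ignore a level set [|x - phi x| <= d].

   For the last part, the branches of the binary tree give continuum many almost
   disjoint infinite sets, each reciprocal-summable for a suitable numbering of
   the vertices. Spreading the [i]-th coordinate of a finitely supported family
   along the [i]-th branch is isometric modulo [c0]: beyond a finite level the
   branches involved are disjoint. *)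
Require Import Defs.
From HB Require Import structures.
From mathcomp Require Import all_boot all_order all_algebra.
From mathcomp Require Import all_classical all_reals.
From mathcomp Require Import topology normedtype sequences.
From mathcomp Require Import complex.

Set Implicit Arguments.
Unset Strict Implicit.
Unset Printing Implicit Defensive.

Import Order.TTheory GRing.Theory Num.Theory.
Import numFieldNormedType.Exports.

Local Open Scope classical_set_scope.
Local Open Scope ring_scope.
Local Open Scope card_scope.
Local Open Scope complex_scope.

(** * Sets of indices with convergent reciprocal sum *)

Section ReciprocalSummable.
Variable R : realType.
Local Notation summable := (reciprocal_summable R).

Let term (A : set nat) (n : nat) : R := if n \in A then harmonic n else 0.

Let term_ge0 A n : 0 <= term A n.
Proof. by rewrite /term; case: ifP => // _; exact: harmonic_ge0. Qed.

Lemma reciprocal_summable_sub (A B : set nat) :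
  A `<=` B -> summable B -> summable A.
Proof.
move=> AB; apply: series_le_cvg => n; [exact: term_ge0|exact: term_ge0|].
case: ifPn => [/set_mem/AB/mem_set -> //|_]; exact: term_ge0.
Qed.

Lemma reciprocal_summableU (A B : set nat) :
  summable A -> summable B -> summable (A `|` B).
Proof.
move=> sA sB; have sAB := is_cvg_seriesD sA sB.
apply: series_le_cvg sAB => n; [exact: term_ge0| |].
  by apply: addr_ge0; exact: term_ge0.
rewrite /GRing.add/=; case: ifPn => [/set_mem[/mem_set An|/mem_set Bn]|_] /=.
- by rewrite An lerDl; exact: term_ge0.
- by rewrite Bn lerDr; exact: term_ge0.
- by apply: addr_ge0; exact: term_ge0.
Qed.

(** Partial sums are dominated by the geometric series of ratio 1/2: a value in the range is charged
    to one of its indices [k], where its reciprocal is at most [2^-k]. *)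
Lemma reciprocal_summable_range (a : nat -> nat) :
  (forall k, (2 ^ k <= (a k).+1)%N) -> summable (range a).
Proof.
move=> ha; apply: nondecreasing_is_cvgn.
  by apply: nondecreasing_series => n _ _; exact: term_ge0.
exists 2 => _ [N _ <-]; rewrite /series /=.
have ge0 n k : 0 <= (if n == a k then 2^-1 ^+ k else 0 : R).
  by case: ifP => _; rewrite ?exprn_ge0 ?invr_ge0.
apply: (@le_trans _ _ (\sum_(0 <= n < N) \sum_(0 <= k < N)
    (if n == a k then 2^-1 ^+ k else 0))).
  rewrite !big_nat; apply: ler_sum => n /= nN.
  case: ifPn => [/set_mem[k _ ak]|_]; last exact: sumr_ge0.
  (* [k < 2 ^ k <= (a k).+1] gives [k <= a k = n < N], so the inner sum up to [N] contains the term
     of [k]. *)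
  have kN : (k < N)%N.
    apply: leq_ltn_trans nN; rewrite -ak -ltnS.
    by apply: leq_trans (ha k); exact: ltn_expl.
  rewrite (bigD1_seq k) ?iota_uniq ?mem_index_iota//= -ak eqxx.
  apply: ler_wpDr; first exact: sumr_ge0.
  by rewrite exprVn -natrX lef_pV2 ?posrE ?ltr0n ?expn_gt0// ler_nat ha.
rewrite exchange_big/=.
apply: (@le_trans _ _ (\sum_(0 <= k < N) 2^-1 ^+ k)).
  apply: ler_sum => k _.
  have [kN|kN] := boolP (a k \in index_iota 0 N).
    rewrite (bigD1_seq (a k)) ?iota_uniq//= eqxx big1 ?addr0// => i.
    by move=> /negPf ->.
  rewrite big_seq big1 ?exprn_ge0 ?invr_ge0// => i iN.
  by case: eqP => // iE; move: kN; rewrite -iE iN.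
have h : (2^-1 : R) != 1 by rewrite invr_eq1 pnatr_eq1.
have := geometric_seriesE (1 : R) h => /(congr1 (fun f => f N)).
rewrite /series /=; under eq_bigr do rewrite mul1r.
move=> ->; rewrite mul1r ler_pdivrMr ?subr_gt0 ?invf_lt1 ?ltr1n//.
have -> : 2 * (1 - 2^-1) = 1 :> R.
  by rewrite mulrBr mulr1 divff ?pnatr_eq0// (_ : 2 = 1 + 1) ?addrK.
by rewrite gerBl exprn_ge0 ?invr_ge0.
Qed.

Lemma reciprocal_summable1 (n : nat) : summable [set n].
Proof.
(* The shift by [(2 ^ k).-1] vanishes at [k = 0] and provides the growth required of the range. *)
apply: (@reciprocal_summable_sub _ (range (fun k => n + (2 ^ k).-1)%N)).
  by move=> _ ->; exists 0%N => //; rewrite addn0.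
apply: reciprocal_summable_range => k.
by rewrite -addnS prednK ?expn_gt0// leq_addl.
Qed.

Lemma reciprocal_summable0 : summable set0.
Proof.
apply: (@reciprocal_summable_sub _ [set 0%N]) => //.
exact: reciprocal_summable1.
Qed.

Lemma reciprocal_summableTN : ~ summable setT.
Proof.
move=> h; apply: (@dvg_harmonic R); move: h; rewrite /reciprocal_summable.
by under eq_fun do rewrite in_setT.
Qed.

End ReciprocalSummable.

(** * Bounded functions: construction and pointwise rules *)

Section BoundedFunctions.
Variables (R : realType) (T : Type).
Implicit Types x y : bfun R T.

Definition bfun_of (f : T -> R[i]^o) (M : R[i]) (M0 : 0 <= M)
  (fM : forall t, `|f t| <= M) : bfun R T :=
  BFun (asboolT (iffRL (Defs.bounded_funP f) (ex_intro2 _ _ M M0 fM))).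

Lemma bfun_ext x y : (forall t, x t = y t) -> x = y.
Proof. by move=> xy; apply/val_inj/funext. Qed.

Lemma bfunDE x y t : (x + y) t = x t + y t :> R[i]. Proof. by []. Qed.
Lemma bfunNE x t : (- x) t = - x t :> R[i]. Proof. by []. Qed.
Lemma bfunZE k x t : (k *: x) t = k * x t :> R[i]. Proof. by []. Qed.
Lemma bfunME x y t : (x ** y) t = x t * y t :> R[i]. Proof. by []. Qed.
Definition bfunE := (bfunDE, bfunNE, bfunZE, bfunME).

End BoundedFunctions.

(** * The closed ideal [s0] and its dense part [s00] *)

Section SequenceIdeal.
Variable R : realType.
Local Notation C := R[i].
Local Notation linfty := (linfty R).

(** Positivity in [R[i]] forces [e] to be real, so thresholds can be taken where the norms have
    their values. *)
Lemma s0P (x : linfty) : s0 x <->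
  forall e : C, 0 < e -> reciprocal_summable R [set n | e <= `|x n|].
Proof.
split=> [sx e e0|sx e e0]; last by apply: sx; rewrite ltcR.
rewrite (ge0_ReE (ltW e0)); apply: sx.
by rewrite -ltcR -ge0_ReE// ltW.
Qed.

(** Each closure property places a level set at [e] inside level sets of the given elements at
    another threshold: [e / 2] for limits and sums, [e / (M + 1)] for products with a factor bounded
    by [M], the 1 keeping the divisor positive. *)
Lemma s0_closed_ideal : closed_ideal (@s0 R).
Proof.
split; last first.
  move=> x clx; apply/s0P => e e0.
  have e2 : 0 < e / 2 by rewrite divr_gt0.
  have [y [/s0P/(_ _ e2) sy]] := clx _ (nbhsx_ballx x _ e2).
  rewrite -ball_normE/= => xy; apply: (reciprocal_summable_sub _ sy) => n /= ex.
  have h := le_lt_trans (bfun_norm_ub (x - y) n) xy.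
  rewrite -(lerD2l (e / 2)) -splitr (le_trans ex)// -[x n](subrK (y n)).
  by rewrite (le_trans (ler_normD _ _))// lerD2r ltW.
have mul (f g : linfty) : s0 g -> s0 (bfun_mul f g).
  move=> /s0P sg; apply/s0P => e e0; have [M M0 fM] := bfunP f.
  have M1 : 0 < M + 1 by rewrite ltr_wpDl.
  apply: (reciprocal_summable_sub _ (sg _ (divr_gt0 e0 M1))) => n /= efg.
  rewrite ler_pdivrMr// (le_trans efg)// normrM mulrC ler_wpM2l//.
  by rewrite (le_trans (fM n))// lerDl.
split.
- apply/s0P => e e0; apply: (@reciprocal_summable_sub _ _ set0).
    by move=> n /=; rewrite normr0 => /(lt_le_trans e0); rewrite ltxx.
  exact: reciprocal_summable0.
- move=> f g /s0P sf /s0P sg; apply/s0P => e e0.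
  have e2 : 0 < e / 2 by rewrite divr_gt0.
  apply: (reciprocal_summable_sub _ (reciprocal_summableU (sf _ e2) (sg _ e2))).
  move=> n /= efg; apply: contrapT => /not_orP[/negP nf /negP ng].
  move: efg; apply/negP; rewrite -!real_ltNge ?ger0_real// ?ltW// in nf ng *.
  by rewrite (le_lt_trans (ler_normD _ _))// [ltRHS]splitr ltrD.
- move=> k f /s0P sf; apply/s0P => e e0.
  have k1 : 0 < `|k| + 1 by rewrite ltr_wpDl.
  apply: (reciprocal_summable_sub _ (sf _ (divr_gt0 e0 k1))) => n /= ekf.
  rewrite ler_pdivrMr// (le_trans ekf)// [leLHS]normrM mulrC ler_wpM2l//.
  by rewrite lerDl.
- move=> f g sg; split; first exact: mul.
  suff -> : g ** f = bfun_mul f g by exact: mul.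
  by apply/val_inj/funext => n; exact: mulrC.
Qed.

Let indic_le1 (A : set nat) n : `|(if n \in A then 1 else 0 : C^o)| <= 1.
Proof. by case: ifP; rewrite ?normr1 ?normr0. Qed.

Definition indic_seq (A : set nat) : linfty := bfun_of ler01 (indic_le1 A).

Lemma indic_seqE A n : indic_seq A n = if n \in A then 1 else 0.
Proof. by []. Qed.

Lemma s0_supported (A : set nat) (x : linfty) :
  reciprocal_summable R A -> (forall n, x n != 0 -> A n) -> s0 x.
Proof.
move=> sA xA; apply/s0P => e e0.
apply: (reciprocal_summable_sub _ sA) => n /= ex.
by apply: xA; rewrite -normr_gt0 (lt_le_trans e0).
Qed.

Lemma s0_indic A : reciprocal_summable R A -> s0 (indic_seq A).
Proof.
move=> /s0_supported; apply=> n; rewrite indic_seqE.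
by case: ifPn => [/set_mem//|]; rewrite eqxx.
Qed.

(** Multiplying by the indicator of [[set n]] shows that an identity equals 1 at every [n]; its
    level set at 1 would be all of [nat], against the divergence of the harmonic series. *)
Lemma s0_non_unital (sub : subalgebra (@s0 R)) : ~ unital (subalg sub).
Proof.
move=> [u hu]; apply: (@reciprocal_summableTN R).
have /s0P/(_ _ ltr01) := subalgP u; apply: reciprocal_summable_sub => n _ /=.
pose d : subalg sub := Subalg (asboolT (s0_indic (@reciprocal_summable1 R n))).
have ud : subalg_val u n * indic_seq [set n] n = indic_seq [set n] n :=
  congr1 (fun z : subalg sub => (subalg_val z : linfty) n) (hu d).1.
by move: ud; rewrite indic_seqE mem_set// mulr1 => ->; rewrite normr1.
Qed.

Lemma s00_sub_s0 : @s00 R `<=` @s0 R.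
Proof. by move=> x sx; apply: (s0_supported sx). Qed.

Lemma s00_dense : @s0 R `<=` closure (@s00 R).
Proof.
move=> x /s0P sx U /nbhs_ballP[e /= e0 eU].
have e2 : 0 < e / 2 by rewrite divr_gt0.
have [M M0 xM] := bfunP x.
(* Truncating the entries below [e / 2] leaves a support inside a level set of [x] and moves [x] by
   at most [e / 2]. *)
pose f n : C^o := if e / 2 <= `|x n| then x n else 0.
have fM n : `|f n| <= M by rewrite /f; case: ifP; rewrite ?normr0.
exists (bfun_of M0 fM); split.
  apply: (reciprocal_summable_sub _ (sx _ e2)) => n /=.
  by rewrite /f; case: ifP; rewrite ?eqxx.
apply: eU; rewrite -ball_normE/=.
apply: (@le_lt_trans _ _ (e / 2)); last first.
  by rewrite ltr_pdivrMr// ltr_pMr// ltr1n.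
apply: bfun_norm_le => [|n]; first exact: ltW.
rewrite [X in `|X|](_ : _ = x n - f n)// /f; case: ifPn => [_|].
  by rewrite subrr normr0 ltW.
by rewrite -real_ltNge ?ger0_real ?(ltW e2)// subr0 => /ltW.
Qed.

End SequenceIdeal.

(** * Subspaces, density and directed covers *)

Section Topology.

Lemma nbhs_subtype (T : topologicalType) (Y : set T) (y : Y) (N : set Y) :
  nbhs y N -> exists V, [/\ open V, V (set_val y) & set_val @^-1` V `<=` N].
Proof. by rewrite nbhsE => -[W [[V oV <-] Vy] WN]; exists V. Qed.

Lemma set_val_continuous (T : topologicalType) (Y : set T) :
  continuous (set_val : Y -> T).
Proof. exact: initial_continuous. Qed.

Lemma compact_subtype (T : topologicalType) (K Y : set T) :
  K `<=` Y -> compact K -> compact (set_val @^-1` K : set Y).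
Proof.
move=> KY cK F PF FK.
have [p [Kp clp]] := cK ((set_val : Y -> T) @ F) _ FK.
exists (exist _ p (mem_set (KY p Kp))); split; first by [].
move=> A N FA /nbhs_subtype[V [oV Vp VN]].
have pV := open_nbhs_nbhs (conj oV Vp).
have [|_ [[y Ay <-] Vy]] := clp (set_val @` A) V _ pV.
  by apply: (@filterS _ F _ A) => // y Ay; exists y.
by exists y; split => //; exact: VN.
Qed.

Lemma continuous_inj_hausdorff (T U : topologicalType) (f : T -> U) :
  injective f -> continuous f -> hausdorff_space U -> hausdorff_space T.
Proof.
move=> fI cf hU p q clpq; apply/fI/hU => A B fA fB.
by have [z [Az Bz]] := clpq _ _ (cf p _ fA) (cf q _ fB); exists (f z).
Qed.

Lemma eq_continuous_dense (T U : topologicalType) (D : set T) (f g : T -> U) :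
  hausdorff_space U -> continuous f -> continuous g -> dense D ->
  (forall x, D x -> f x = g x) -> f = g.
Proof.
move=> hU cf cg dD fg; apply/funext => x; apply: hU => A B fA gB.
have : nbhs x (f @^-1` A `&` g @^-1` B).
  by apply: filterI; [exact: cf|exact: cg].
rewrite nbhsE => -[O [oO Ox] OAB].
have [z [Oz Dz]] := dD O (ex_intro _ x Ox) oO.
by exists (f z); have [Az Bz] := OAB _ Oz; split => //; rewrite fg.
Qed.

(** If no [U i] contains [K], directedness makes the differences of [K] and [U i] a base of a proper
    filter; its cluster point in [K] lies in some [U i], which a member of the filter avoids. *)
Lemma compact_directed_cover (T : topologicalType) (K : set T) (I : Type)
    (D : set I) (U : I -> set T) :
  compact K -> D !=set0 ->
  (forall i j, D i -> D j -> exists2 k, D k & U i `|` U j `<=` U k) ->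
  (forall i, D i -> open (U i)) -> K `<=` \bigcup_(i in D) U i ->
  exists2 i, D i & K `<=` U i.
Proof.
move=> cK [i0 Di0] dir oU KU; apply: contrapT => hn.
pose F := filter_from D (fun i => K `\` U i).
have PF : ProperFilter F.
  apply: filter_from_proper; last first.
    move=> i Di; apply: contrapT => hi; apply: hn; exists i => // x Kx.
    by apply: contrapT => Ux; apply: hi; exists x.
  apply: filter_from_filter; first by exists i0.
  move=> i j Di Dj; have [k Dk Uk] := dir _ _ Di Dj; exists k => // x [Kx Ux].
  by split; split => // h; apply: Ux; apply: Uk; [left|right].
have [|p [Kp clp]] := cK F PF; first by exists i0 => // x [].
have [i Di Uip] := KU p Kp.
have pU := open_nbhs_nbhs (conj (oU _ Di) Uip).
have [|x [[_ +] Ux]] := clp (K `\` U i) (U i) _ pU.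
  by exists i.
by apply.
Qed.

Lemma continuous_nat (T : topologicalType) (f : nat -> T) : continuous f.
Proof.
move=> n U /nbhs_singleton fU; rewrite nbhs_principalE.
exact/principal_filterP.
Qed.

End Topology.

(** * Complex numbers: discs and continuity by coordinates *)

Section ComplexTopology.
Variable R : realType.
Local Notation C := R[i].

Lemma closed_disc (c : C^o) (r : C) : closed [set z : C^o | `|z - c| <= r].
Proof.
move=> z clz /=; apply/ler_addgt0Pr => d d0.
have [w [/= wc]] := clz _ (nbhsx_ballx z d d0); rewrite -ball_normE/= => zw.
rewrite -(subrK w z) -addrA (le_trans (ler_normD _ _))//.
by rewrite [leRHS]addrC lerD ?(ltW zw).
Qed.

Lemma norm_real_complex (x : R) : `|x%:C| = `|x|%:C.
Proof. by rewrite normc_def/= expr0n addr0 sqrtr_sqr. Qed.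

Lemma normc_ge_Im (z : C) : `|complex.Im z|%:C <= `|z|.
Proof. by rewrite normc_def lecR -sqrtr_sqr ler_wsqrtr// lerDr sqr_ge0. Qed.

Lemma norm_imag : `|'i : C| = 1.
Proof. by rewrite normc_def/= expr0n expr1n add0r sqrtr1. Qed.

Lemma continuous_complex (T : topologicalType) (u v : T -> R) :
  continuous u -> continuous v -> continuous (fun t => u t +i* v t : C^o).
Proof.
move=> cu cv t; apply/cvgrPdist_lt => e e0.
have er : 0 < complex.Re e by rewrite -ltcR -ge0_ReE// ltW.
have er2 : 0 < complex.Re e / 2 by rewrite divr_gt0.
have /cvgrPdist_lt/(_ _ er2) hu := cu t.
have /cvgrPdist_lt/(_ _ er2) hv := cv t.
near=> s.
rewrite (_ : _ - _ = (u t - u s)%:C + 'i * (v t - v s)%:C); last first.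
  by rewrite [LHS]complexE/=.
rewrite (le_lt_trans (ler_normD _ _))// normrM !norm_real_complex norm_imag.
rewrite mul1r -rmorphD (ge0_ReE (ltW e0)) ltcR [ltRHS]splitr.
by rewrite ltrD//; near: s; assumption.
Unshelve. all: by end_near. Qed.

End ComplexTopology.

(** * Extension to the compactification and its clopen sets *)

Section StoneCech.
Variables (R : realType) (B : topologicalType) (e : nat -> B).
Hypothesis hB : stone_cech e.
Local Notation C := R[i].
Local Notation linfty := (linfty R).
Local Notation cl A := (closure (e @` A)).

Let cB : compact [set: B]. Proof. by case: hB. Qed.
Let hausB : hausdorff_space B. Proof. by case: hB. Qed.
Let dB : dense (range e). Proof. by case: hB. Qed.

(** The universal property asks for a compact Hausdorff target, here the interval from [- M] to [M]
    as a subtype. *)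
Lemma extend_real (u : nat -> R) (M : R) : (forall n, `|u n| <= M) ->
  exists2 g : B -> R, continuous g & forall n, g (e n) = u n.
Proof.
move=> uM; pose K := [set x : R | x \in `[- M, M]].
have uK n : K (u n) by rewrite /K/= in_itv/= -ler_norml.
pose f n : K := exist _ (u n) (mem_set (uK n)).
have [_ _ _ _ /(_ K f)] := hB; case.
- have -> : [set: K] = set_val @^-1` K.
    by apply/seteqP; split=> // x _; exact: set_valP.
  by apply: compact_subtype => //; exact: segment_compact.
- apply: (continuous_inj_hausdorff (f := set_val)) (@Rhausdorff R).
    exact: val_inj.
  exact: set_val_continuous.
- exact: continuous_nat.
move=> g cg gf; exists (set_val \o g) => [x|n].
  by apply: continuous_comp; [exact: cg|exact: set_val_continuous].
by rewrite /= -[g (e n)]/((g \o e) n) gf.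
Qed.

Lemma extend_ex (x : linfty) :
  exists g : B -> C^o, continuous g /\ forall n, g (e n) = x n.
Proof.
have [M M0 xM] := bfunP x.
have ReM n : `|complex.Re (x n)| <= complex.Re M.
  by rewrite -lecR -ge0_ReE// (le_trans (normc_ge_Re _)).
have ImM n : `|complex.Im (x n)| <= complex.Re M.
  by rewrite -lecR -ge0_ReE// (le_trans (normc_ge_Im _)).
have [u cu uE] := extend_real ReM; have [v cv vE] := extend_real ImM.
exists (fun b => u b +i* v b); split; first exact: continuous_complex.
by move=> n; rewrite uE vE; case: (x n).
Qed.

Definition extend (x : linfty) : B -> C^o := projT1 (cid (extend_ex x)).

Lemma extend_continuous x : continuous (extend x).
Proof. by rewrite /extend; case: cid => g [? ?]. Qed.

Lemma extendE x n : extend x (e n) = x n.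
Proof. by rewrite /extend; case: cid => g [? ?]. Qed.

Lemma extend_uniq (x : linfty) (g : B -> C^o) :
  continuous g -> (forall n, g (e n) = x n) -> g = extend x.
Proof.
move=> cg gE; apply: (eq_continuous_dense (D := range e)).
- exact: norm_hausdorff.
- exact: cg.
- exact: extend_continuous.
- exact: dB.
- by move=> _ [n _ <-]; rewrite gE extendE.
Qed.

Lemma extend_closure (x : linfty) (A : set nat) (P : set C^o) p :
  closed P -> (forall n, A n -> P (x n)) -> cl A p -> P (extend x p).
Proof.
move=> cP xP; suff: cl A `<=` extend x @^-1` P by apply.
have /closure_id -> : closed (extend x @^-1` P).
  by apply: preimage_closed => // ? _; exact: extend_continuous.
by apply: closureS => _ [n An <-]; rewrite /= extendE; exact: xP.
Qed.

Lemma extend_disc (x : linfty) (A : set nat) (c : C^o) (r : C) p :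
  (forall n, A n -> `|x n - c| <= r) -> cl A p -> `|extend x p - c| <= r.
Proof. exact: (@extend_closure x A _ p (closed_disc (c := c) (r := r))). Qed.

Lemma extend_eq (x : linfty) (A : set nat) (c : C^o) p :
  (forall n, A n -> x n = c) -> cl A p -> extend x p = c.
Proof.
move=> xc clA; apply/eqP; rewrite -subr_eq0 -normr_le0.
by apply: extend_disc clA => n /xc ->; rewrite subrr normr0.
Qed.

Lemma closure_image_setC A p : cl A p \/ cl (~` A) p.
Proof.
have : closure (range e) p.
  move=> U; rewrite nbhsE => -[V [oV Vp] VU].
  have [q [Vq eq]] := dB (ex_intro _ p Vp) oV.
  by exists q; split=> //; exact: VU.
by rewrite -(setUv A) image_setU closureU.
Qed.

(** The extended indicator of [A] would be both 1 and 0 at [p]. *)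
Lemma closure_image_setCN A p : cl A p -> cl (~` A) p -> False.
Proof.
move=> Ap CAp; have : extend (indic_seq R A) p = 1.
  by apply: extend_eq Ap => n An; rewrite indic_seqE mem_set.
rewrite (extend_eq _ CAp (c := 0)) => [/eqP|n An].
  by rewrite eq_sym oner_eq0.
by rewrite indic_seqE memNset.
Qed.

(** The complement of [cl A] is the closure belonging to the complementary index set, hence
    closed. *)
Lemma closure_image_open A : open (cl A).
Proof.
rewrite -[cl A]setCK; apply: closed_openC.
suff -> : ~` cl A = cl (~` A) by exact: closed_closure.
apply/seteqP; split=> p; first by case: (closure_image_setC A p).
by move=> + Ap; exact: closure_image_setCN.
Qed.

Lemma closure_image_compact A : compact (cl A).
Proof. by apply: subclosed_compact cB _ => //; exact: closed_closure. Qed.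

Lemma closure_imageE A n : cl A (e n) <-> A n.
Proof.
split=> [clA|An]; last by apply: subset_closure; exists n.
apply: contrapT => An; apply: closure_image_setCN clA _.
by apply: subset_closure; exists n.
Qed.

Lemma closure_image_setI A A' p : cl A p -> cl A' p -> cl (A `&` A') p.
Proof.
move=> Ap A'p; have [//|] := closure_image_setC (A `&` A') p.
rewrite setCI image_setU closureU => -[CAp|CA'p].
  by case: (closure_image_setCN Ap CAp).
by case: (closure_image_setCN A'p CA'p).
Qed.

(** By regularity some neighbourhood [U] of [p] has its closure inside [V]; [A] consists of the
    indices that [e] sends into [U], and density of [range e] puts [p] in [cl A]. *)
Lemma closure_image_basis p (V : set B) : nbhs p V ->
  exists2 A, cl A p & cl A `<=` V.
Proof.
move=> Vp.
have reg := compact_regular hausB cB (@filterT _ _ (nbhs_filter p)).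
have [U Up UV] := reg _ Vp.
exists (e @^-1` U); last first.
  by apply: subset_trans UV; apply: closureS => _ [n Un <-].
move: Up; rewrite nbhsE => -[W [oW Wp] WU] N; rewrite nbhsE => -[O [oO Op] ON].
have [q [[Wq Oq] [n _ nq]]] : (W `&` O) `&` range e !=set0.
  by apply: dB; [exists p|exact: openI].
by exists q; split; [exists n => //; rewrite /= nq; exact: WU|exact: ON].
Qed.

End StoneCech.

(** * The space [Y] and the isomorphism of [s0] with [C0 R Y] *)

Section SummableClosure.
Variables (R : realType) (B : topologicalType) (e : nat -> B).
Hypothesis hB : stone_cech e.
Variable sub : subalgebra (@s0 R).
Local Notation C := R[i].
Local Notation linfty := (linfty R).
Local Notation summable := (reciprocal_summable R).
Local Notation cl A := (closure (e @` A)).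
Local Notation Y := (reciprocal_summable_closure R e).
Local Notation extend := (extend hB).

Lemma closure_sub_summable A : summable A -> cl A `<=` Y.
Proof. by move=> sA p Ap; exists A. Qed.

Lemma range_sub_summable : range e `<=` Y.
Proof.
move=> _ [n _ <-]; apply: (closure_sub_summable (@reciprocal_summable1 R n)).
exact/(closure_imageE R hB).
Qed.

Definition nat_summable n : Y :=
  exist _ (e n) (mem_set (range_sub_summable (imageT e n))).

Lemma dense_nat_summable : dense [set y : Y | range e (set_val y)].
Proof.
move=> O [y Oy] [V oV VO].
have [_ _ _ dB _] := hB.
rewrite -VO in Oy *.
have [q [Vq [n _ nE]]] := dB V (ex_intro _ (set_val y) Oy) oV.
by exists (nat_summable n); split; [rewrite -nE in Vq|exists n].
Qed.

Lemma compact_closure_summable A :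
  summable A -> compact (set_val @^-1` (cl A) : set Y).
Proof.
move=> sA; apply: compact_subtype; first exact: closure_sub_summable.
exact: closure_image_compact.
Qed.

Lemma open_closure_summable A : open (set_val @^-1` (cl A) : set Y).
Proof. by exists (cl A) => //; exact: closure_image_open. Qed.

(** The sets [cl A] with [A] summable form an open cover of [Y] directed under unions, so one of
    them contains [K]. *)
Lemma compact_sub_summable (K : set Y) : compact K ->
  exists2 A, summable A & forall n, K (nat_summable n) -> A n.
Proof.
move=> cK; have [|||y _|A sA KA] := compact_directed_cover
    (U := fun A => set_val @^-1` (cl A) : set Y) (D := summable) cK.
- by exists set0; exact: reciprocal_summable0.
- move=> A A' sA sA'; exists (A `|` A'); first exact: reciprocal_summableU.
  by rewrite /= image_setU closureU.
- by move=> A _; exact: open_closure_summable.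
- by have [A sA Ay] := set_valP y; exists A.
by exists A => // n /KA /(closure_imageE R hB).
Qed.

Lemma locally_compact_summable : locally_compact [set: Y].
Proof.
move=> y _; have [A sA Ay] := set_valP y.
exists (set_val @^-1` (cl A)); last first.
  split; first exact: compact_closure_summable.
  apply: preimage_closed (@closed_closure _ _) => x _.
  exact: set_val_continuous.
apply: (@filterS _ (nbhs y) _ (set_val @^-1` (cl A))) => //.
by apply: open_nbhs_nbhs; split; [exact: open_closure_summable|exact: Ay].
Qed.

Lemma noncompact_summable : ~ compact [set: Y].
Proof.
move=> /compact_sub_summable[A sA hA]; apply: (@reciprocal_summableTN R).
by apply: reciprocal_summable_sub sA => n _; exact: hA.
Qed.

Lemma extend_bound (x : linfty) (M : C) p :
  (forall n, `|x n| <= M) -> `|extend x p| <= M.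
Proof.
move=> xM; rewrite -[extend x p]subr0.
apply: (extend_disc hB (A := setT)) => [n _|]; first by rewrite subr0.
have [//|] := closure_image_setC hB setT p.
by rewrite setCT image_set0 closure0.
Qed.

Lemma extend_val_bounded (x : linfty) (y : Y) : `|extend x (set_val y)| <= `|x|.
Proof. by apply: extend_bound => n; exact: bfun_norm_ub. Qed.

Definition extend_bfun (x : linfty) : bfun R Y :=
  bfun_of (normr_ge0 x) (extend_val_bounded x).

Lemma extend_bfun_C0 x : s0 x -> @C0_set R Y (extend_bfun x).
Proof.
move=> /s0P sx.
have cx : continuous (extend_bfun x : Y -> C^o).
  move=> y; apply: (@continuous_comp _ _ _ (set_val : Y -> B) (extend x)).
    exact: set_val_continuous.
  exact: extend_continuous.
split=> // n n0.
have n0' : 0 < n%:R^-1 :> C by rewrite invr_gt0 ltr0n.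
(* Halving leaves a margin: off the closure of this level set the extension obeys only a non-strict
   bound by the threshold, which must still be below [n%:R^-1]. *)
have n2 : 0 < n%:R^-1 / 2 :> C by rewrite divr_gt0.
apply: subclosed_compact (compact_closure_summable (sx _ n2)) _.
  exact: norm_ge_closed.
move=> y /= ny; have [yA|yC] := closure_image_setC hB
    [set m | n%:R^-1 / 2 <= `|x m|] (set_val y).
  exact: yA.
suff /(le_trans ny) : `|extend x (set_val y)| <= n%:R^-1 / 2.
  by rewrite ler_pdivlMr// ger_pMr// lern1.
rewrite -[extend x _]subr0; apply: (extend_disc hB) yC => m /negP.
by rewrite subr0 -real_ltNge ?ger0_real ?(ltW n2)// => /ltW.
Qed.

Definition gelfand (x : subalg sub) : C0 R Y :=
  Subalg (asboolT (extend_bfun_C0 (subalgP x))).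

Lemma extend_linear (k : C) (x y : linfty) p :
  extend (k *: x + y) p = k * extend x p + extend y p.
Proof.
rewrite -(@extend_uniq _ _ _ hB (k *: x + y)
  (fun p => k * extend x p + extend y p))// => [q|n].
  apply: cvgD; last exact: extend_continuous.
  by apply: cvgM; [exact: cvg_cst|exact: extend_continuous].
by rewrite !extendE.
Qed.

Lemma extend_mul (x y : linfty) p :
  extend (x ** y) p = extend x p * extend y p.
Proof.
rewrite -(@extend_uniq _ _ _ hB (x ** y)
  (fun p => extend x p * extend y p))// => [q|n].
  by apply: cvgM; exact: extend_continuous.
by rewrite !extendE.
Qed.

Lemma extend_norm (x : linfty) : `|extend_bfun x| = `|x|.
Proof.
apply/le_anti/andP; split; apply: bfun_norm_le => //.
  by move=> y; exact: extend_val_bounded.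
move=> n; have := bfun_norm_ub (extend_bfun x) (nat_summable n).
by rewrite /= extendE.
Qed.

(** Restriction to the embedded copy of [nat]; on [C0_set] it inverts the extension, by density of
    that copy in [Y]. *)
Definition gelfand_inv_seq (g : bfun R Y) : linfty :=
  bfun_of (normr_ge0 g) (fun n => bfun_norm_ub g (nat_summable n)).

Lemma s0_gelfand_inv (g : bfun R Y) : C0_set g -> s0 (gelfand_inv_seq g).
Proof.
move=> Cg; apply/s0P => d d0.
have [A sA KA] := compact_sub_summable (C0_compact Cg d0).
by apply: reciprocal_summable_sub sA => n /= dn; exact: KA.
Qed.

Lemma extend_gelfand_inv (g : bfun R Y) : C0_set g ->
  extend_bfun (gelfand_inv_seq g) = g.
Proof.
move=> Cg; apply: val_inj.
apply: (eq_continuous_dense (D := [set y : Y | range e (set_val y)])).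
- exact: norm_hausdorff.
- exact: (extend_bfun_C0 (s0_gelfand_inv Cg)).1.
- exact: Cg.1.
- exact: dense_nat_summable.
move=> y [n _ ny]; have -> : y = nat_summable n by exact: val_inj.
by rewrite /= extendE.
Qed.

Lemma gelfand_isomorphism : isometrically_isomorphic (subalg sub) (C0 R Y).
Proof.
exists gelfand; split.
- exists (fun g => Subalg (asboolT (s0_gelfand_inv (subalgP g)))) => [x|g].
    by apply/val_inj/val_inj/funext => n; rewrite /= extendE.
  by apply: val_inj; exact: (extend_gelfand_inv (subalgP g)).
- by move=> k x y; apply/val_inj/val_inj/funext => p; exact: extend_linear.
- by move=> x y; apply/val_inj/val_inj/funext => p; exact: extend_mul.
- by move=> x; exact: extend_norm.
Qed.

End SummableClosure.

(** * Characters of [s0] as points of [Y] *)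

Section Characters.
Variables (R : realType) (B : topologicalType) (e : nat -> B).
Hypothesis hB : stone_cech e.
Local Notation C := R[i].
Local Notation linfty := (linfty R).
Local Notation summable := (reciprocal_summable R).
Local Notation cl A := (closure (e @` A)).
Local Notation Y := (reciprocal_summable_closure R e).
Local Notation extend := (extend hB).
Local Notation ind := (indic_seq R).

Lemma indic_setI A A' : ind (A `&` A') = ind A ** ind A'.
Proof.
apply: bfun_ext => n; rewrite !bfunE !indic_seqE in_setI.
by case: (n \in A); case: (n \in A'); rewrite ?mulr1 ?mulr0.
Qed.

Variable phi : linfty -> C.
Hypothesis phiL :
  forall k x y, s0 x -> s0 y -> phi (k *: x + y) = k * phi x + phi y.
Hypothesis phiM : forall x y, s0 x -> s0 y -> phi (x ** y) = phi x * phi y.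
Hypothesis phi_neq0 : exists2 x, s0 x & phi x != 0.

Let ideal_s0 : ideal (@s0 R) := (s0_closed_ideal R).1.

(* If [x - phi x] has a bounded inverse [w'] on a set [D], then [w := w' 1_D]
   gives [phi 1_D = 0]; this replaces the continuity of [phi]. *)
Lemma phi_resolvent x w : s0 x -> s0 w -> phi (x ** w - phi x *: w) = 0.
Proof.
have [_ _ IZ IM] := ideal_s0 => sx sw.
have sxw : s0 (x ** w) by have [] := IM x w sw.
by rewrite addrC -scaleNr phiL// phiM// mulNr addNr.
Qed.

(** [ind A] is idempotent, so its image is 0 or 1. *)
Lemma phi_indic_eq1 A : summable A -> phi (ind A) != 0 -> phi (ind A) = 1.
Proof.
move=> /s0_indic sA A0; apply: (mulfI A0).
by rewrite mulr1 -phiM// -indic_setI setIid.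
Qed.

(** [A] is a level set, at half the norm of [c], of some [x] with [phi x = c] nonzero. Were
    [phi (ind A)] zero, the part [x'] of [x] off [A] would keep the value [c] although [x' - c] has
    a bounded inverse, and the resolvent identity would give [phi x' = 0]. *)
Lemma phi_summable_ex : exists2 A, summable A & phi (ind A) = 1.
Proof.
have [_ ID IZ IM] := ideal_s0.
have [x sx c0] := phi_neq0; set c := phi x in c0.
have nc : 0 < `|c| / 2 by rewrite divr_gt0// normr_gt0.
pose A := [set n | `|c| / 2 <= `|x n|].
have sA : summable A by move/s0P: sx; apply.
exists A => //; apply: phi_indic_eq1 => //; apply: contraNN c0 => /eqP A0.
have sI := s0_indic sA.
pose x' := x - x ** ind A.
have sxI : s0 (x ** ind A) by have [] := IM x _ sI.
have sx' : s0 x' by apply: ID => //; rewrite -scaleN1r; exact: IZ.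
have px' : phi x' = c.
  rewrite /x' addrC -scaleN1r phiL// phiM// A0 mulr0 mulr0 add0r//.
have x'E n : x' n = if n \in A then 0 else x n.
  rewrite /x' !bfunE indic_seqE.
  by case: ifP => _; rewrite ?mulr1 ?subrr ?mulr0 ?subr0.
have dist n : `|c| / 2 <= `|x' n - c|.
  rewrite x'E; case: ifPn => [_|/negP nA].
    by rewrite sub0r normrN ler_pdivrMr// ler_peMr// ler1n.
  have /ltW xn : `|x n| < `|c| / 2.
    rewrite real_ltNge ?ger0_real ?(ltW nc)//; apply/negP => h.
    by apply: nA; rewrite inE.
  rewrite distrC; apply: le_trans (lerB_dist _ _).
  by rewrite lerBrDr [leRHS]splitr lerD2l.
have zM n : `|(x' n - c)^-1 : C^o| <= (`|c| / 2)^-1.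
  by rewrite normfV lef_pV2// posrE (lt_le_trans nc).
pose z : linfty := bfun_of (ltW (etrans (invr_gt0 _) nc)) zM.
(* The inverse [z] of [x' - c] is only known to be bounded; the ideal property puts [z ** x'] in
   [s0]. *)
have sw : s0 (z ** x') by have [] := IM z _ sx'.
have := phi_resolvent sx' sw; rewrite px'.
suff -> : x' ** (z ** x') - c *: (z ** x') = x' by rewrite px' => ->.
apply: bfun_ext => n.
rewrite !bfunE /=.
rewrite -mulrBl mulrA divff ?mul1r// -normr_gt0.
exact: lt_le_trans nc (dist n).
Qed.

(** On the part of [A] off the level set, [x - phi x] has norm above [d] and can be inverted; hence
    [phi] kills the indicator of that part, and the rest of [A] carries the whole value 1. *)
Lemma phi_level A x (d : C) : summable A -> phi (ind A) = 1 -> s0 x -> 0 < d ->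
  phi (ind ([set n | `|x n - phi x| <= d] `&` A)) = 1.
Proof.
move=> sA A1 sx d0; set c := phi x; set L := [set n | _].
have sLA : summable (L `&` A) by apply: reciprocal_summable_sub sA => n [].
have sD : summable (~` L `&` A) by apply: reciprocal_summable_sub sA => n [].
(* Cutting the inverse off to a subset of [A] makes [w] a member of [s0]. *)
pose f n : C^o := if n \in ~` L `&` A then (x n - c)^-1 else 0.
have fM n : `|f n| <= d^-1.
  rewrite /f; case: ifPn => [/set_mem[/negP nL _]|_]; last first.
    by rewrite normr0 invr_ge0 ltW.
  rewrite normfV lef_pV2// ?posrE//.
    by move: nL; rewrite -real_ltNge ?ger0_real ?(ltW d0)// => /ltW.
  move: nL; rewrite -real_ltNge ?ger0_real ?(ltW d0)//; exact: lt_trans.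
have id0 : 0 <= d^-1 by rewrite invr_ge0 ltW.
pose w : linfty := bfun_of id0 fM.
have sw : s0 w.
  apply: (s0_supported sD) => n /=; rewrite /f.
  by case: ifPn => [/set_mem|]; rewrite ?eqxx.
have := phi_resolvent sx sw.
have -> : x ** w - phi x *: w = ind (~` L `&` A).
  apply: bfun_ext => n; rewrite !bfunE -mulrBl /w /= /f.
  case: ifPn => [/set_mem[nL _]|_]; last by rewrite mulr0.
  rewrite divff// subr_eq0; apply/eqP => xc; apply: nL.
  by rewrite /L/= xc subrr normr0 ltW.
move=> D0; have <- : phi (1 *: ind (L `&` A) + ind (~` L `&` A)) = 1.
  rewrite (_ : _ + _ = ind A)//; apply: bfun_ext => n.
  rewrite !bfunE !indic_seqE mul1r.
  by rewrite !in_setI in_setC; case: (n \in L); case: (n \in A);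
     rewrite /= ?addr0 ?add0r.
by rewrite (phiL 1 (s0_indic sLA) (s0_indic sD)) D0 mul1r addr0.
Qed.

Lemma character_point : exists2 p, Y p & forall x, s0 x -> phi x = extend x p.
Proof.
have [A sA A1] := phi_summable_ex.
have [cB _ [eI _ _] _ _] := hB.
pose F : set_system B := [set S | phi (ind (e @^-1` S `&` A)) = 1].
have sFA S : s0 (ind (S `&` A)).
  by apply/s0_indic/(reciprocal_summable_sub _ sA) => n [].
have FI S S' : F S -> F S' -> F (S `&` S').
  rewrite /F/= => FS FS'.
  by rewrite preimage_setI setIIl indic_setI phiM// FS FS' mulr1.
have PF : ProperFilter F.
  apply: Build_ProperFilter_ex.
    move=> S FS; apply: contrapT => S0; move: FS; rewrite /F/=.
    have -> : S = set0 by apply/seteqP; split=> // b Sb; apply: S0; exists b.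
    rewrite preimage_set0 set0I.
    have -> : ind set0 = 0.
      by apply: bfun_ext => n; rewrite indic_seqE in_set0.
    have s00 : s0 (0 : linfty) by case: ideal_s0.
    (* Linearity at [1 *: 0 + 0] gives [phi 0 = phi 0 + phi 0], hence [phi 0 = 0]. *)
    have := phiL 1 s00 s00; rewrite scaler0 addr0 mul1r => /eqP.
    rewrite -subr_eq0 opprD addrA subrr add0r oppr_eq0 => /eqP ->.
    by move=> /esym/eqP; rewrite oner_eq0.
  split=> //; first by rewrite /F/= preimage_setT setTI.
  move=> S S' SS'; rewrite /F/= => FS.
  have : (e @^-1` S `&` A) = (e @^-1` S `&` A) `&` (e @^-1` S' `&` A).
    apply/seteqP; split=> [n [Sn An]|n []//].
    by do 2!split=> //; exact: SS'.
  by move=> h; move: (FS); rewrite h indic_setI phiM// FS mul1r.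
have [p [_ clp]] := cB F PF filterT.
(* Injectivity of [e] gives back [S] as the preimage of its image, so the image belongs to [F] and
   has [p] in its closure. *)
have pcl S : phi (ind (S `&` A)) = 1 -> cl S p.
  move=> S1 N pN; apply: clp => //; rewrite /F/=.
  suff -> : e @^-1` (e @` S) = S by [].
  by apply/seteqP; split=> [n [m Sm /eI <-//]|n Sn]; exists n.
exists p; first by exists A => //; apply: pcl; rewrite setIid.
move=> x sx; apply/esym/eqP; rewrite -subr_eq0 -normr_le0.
apply/ler_addgt0Pr => d d0; rewrite add0r.
by apply: (extend_disc hB) (pcl _ (phi_level sA A1 sx d0)).
Qed.

End Characters.

(** * The homeomorphism of [Y] with the Gelfand spectrum *)

Section Spectrum.
Variables (R : realType) (B : topologicalType) (e : nat -> B).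
Hypothesis hB : stone_cech e.
Variable sub : subalgebra (@s0 R).
Local Notation C := R[i].
Local Notation linfty := (linfty R).
Local Notation summable := (reciprocal_summable R).
Local Notation cl A := (closure (e @` A)).
Local Notation Y := (reciprocal_summable_closure R e).
Local Notation extend := (extend hB).
Local Notation ind := (indic_seq R).
Local Notation A0 := (subalg sub).
Local Notation Spec := (spectrum (subalg sub)).

Definition s0_elt (x : linfty) (sx : s0 x) : A0 := Subalg (asboolT sx).

Lemma extend_indic A p : cl A p -> extend (ind A) p = 1.
Proof. by apply: extend_eq => n An; rewrite indic_seqE mem_set. Qed.

Lemma extend_indic_neq0 A p : extend (ind A) p != 0 -> cl A p.
Proof.
move=> /eqP p0; have [//|CAp] := closure_image_setC hB A p.
exfalso; apply: p0; apply: (extend_eq hB) CAp => n nA.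
by rewrite indic_seqE memNset.
Qed.

Lemma summable_basis (p : B) (V : set B) : Y p -> nbhs p V ->
  exists A, [/\ summable A, cl A p & cl A `<=` V].
Proof.
move=> [A' sA' A'p] /(closure_image_basis hB)[A Ap AV].
exists (A `&` A'); split; first by apply: reciprocal_summable_sub sA' => n [].
  exact: (closure_image_setI R hB).
by apply: subset_trans AV; apply: closureS; apply: image_subset => n [].
Qed.

Definition evaluation (y : Y) : {ptws A0 -> C^o} :=
  fun x => extend (subalg_val x) (set_val y).

Lemma evaluation_spectrum y : Spec (evaluation y).
Proof.
split; last 2 first.
- by move=> k x z; exact: extend_linear.
- by move=> x z; exact: extend_mul.
have [A sA Ay] := set_valP y; exists (s0_elt (s0_indic sA)).
by rewrite /evaluation/= extend_indic//; apply/eqP; rewrite oner_eq0.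
Qed.

Definition evaluation_character (y : Y) : Spec :=
  exist _ (evaluation y) (mem_set (evaluation_spectrum y)).

(** A basic set [cl A] around [y] is detected by the extended indicator of [A]: its value 1 passes
    from [y] to [z], so [z] lies in every neighbourhood of [y]. *)
Lemma evaluation_inj : injective evaluation_character.
Proof.
have [_ hausB _ _ _] := hB.
move=> y z /(congr1 set_val)/= yz; apply: val_inj => /=.
apply: hausB => V W yV zW.
have [A [sA Ay AV]] := summable_basis (set_valP y) yV.
exists (set_val z); split; last exact: nbhs_singleton.
apply/AV/extend_indic_neq0.
have <- : extend (ind A) (set_val y) = extend (ind A) (set_val z) :=
  congr1 (fun f : {ptws A0 -> C^o} => f (s0_elt (s0_indic sA))) yz.
by rewrite extend_indic// oner_eq0.
Qed.

Lemma evaluation_surj (chi : Spec) : exists y, evaluation_character y = chi.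
Proof.
have [[x0 chi0] chiL chiM] := set_valP chi.
(* Extended by 0 off [s0]: [character_point] expects a function on all of [linfty] but constrains it
   only on [s0]. *)
pose phi (x : linfty) : C :=
  if pselect (s0 x) is left sx then set_val chi (s0_elt sx) else 0.
have phiE (a : A0) : phi (subalg_val a) = set_val chi a.
  rewrite /phi; case: pselect => [sx|[]]; last exact: subalgP.
  by congr (set_val chi _); exact: val_inj.
have phiE' x (sx : s0 x) : phi x = set_val chi (s0_elt sx).
  by rewrite -phiE.
have [|||p Yp phip] := @character_point R B e hB phi.
- move=> k x y sx sy; rewrite (phiE' _ sx) (phiE' _ sy).
  by apply: etrans (chiL _ _ _); exact: (phiE (k *: s0_elt sx + s0_elt sy)).
- move=> x y sx sy; rewrite (phiE' _ sx) (phiE' _ sy).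
  by apply: etrans (chiM _ _); exact: (phiE (s0_elt sx ** s0_elt sy)).
- exists (subalg_val x0); first exact: subalgP.
  by rewrite phiE; apply/eqP.
exists (exist _ p (mem_set Yp)); apply: val_inj => /=; apply/funext => x.
by rewrite /evaluation/= -phip ?phiE//; exact: subalgP.
Qed.

Lemma evaluation_continuous : continuous evaluation_character.
Proof.
apply: continuous_comp_initial => y /=.
have FF : Filter (evaluation @ y).
  exact: (@fmap_filter _ _ evaluation (nbhs y) (nbhs_filter y)).
suff : {ptws, evaluation @ y --> evaluation y} by [].
apply/(@pointwise_cvgP _ _ _ _ FF) => x.
apply: (@continuous_comp _ _ _ (set_val : Y -> B) (extend (subalg_val x))).
  exact: set_val_continuous.
exact: extend_continuous.
Qed.

Lemma spectrum_homeomorphic : homeomorphic Y Spec.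
Proof.
pose g chi := projT1 (cid (evaluation_surj chi)).
have gK : cancel g evaluation_character by move=> chi; rewrite /g; case: cid.
have Kg : cancel evaluation_character g.
  by move=> y; apply: evaluation_inj; rewrite gK.
exists evaluation_character, g; split=> //; first exact: evaluation_continuous.
apply: continuous_comp_initial => chi V /= gV.
have [A [sA Achi AV]] := summable_basis (set_valP (g chi)) gV.
pose a := s0_elt (s0_indic sA).
have gE (psi : Spec) : set_val psi a = extend (ind A) (set_val (g psi)).
  by rewrite -[in LHS](gK psi).
have cev :
    (fun psi : Spec => set_val psi a : C^o) @ chi --> (set_val chi a : C^o).
  apply: (@continuous_comp _ _ _ (set_val : Spec -> {ptws A0 -> C^o})
    (fun f : {ptws A0 -> C^o} => f a)); first exact: set_val_continuous.
  exact: proj_continuous.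
(* A character at distance less than 1 from [chi] at [a] is nonzero there, because [chi] is 1 at
   [a]; hence its point lies in [cl A]. *)
move/cvgrPdist_lt : cev => /(_ _ ltr01); apply: filterS => psi /= h.
apply/AV/extend_indic_neq0; rewrite -gE; apply: contraTN h => /eqP ->.
by rewrite subr0 gE extend_indic// normr1 ltxx.
Qed.

End Spectrum.

(** * Finite index sets and branches of the binary tree *)

Lemma finite_set_induction (T : Type) (P : set T -> Prop) :
  P set0 -> (forall x A, P A -> P (x |` A)) -> forall A, finite_set A -> P A.
Proof.
move=> P0 PU A /finite_setP[n]; elim: n A => [|n IH] A.
  by rewrite II0 card_eq0 => /eqP ->.
by move=> /eq_cardSP[x Ax /IH Px]; rewrite -(setD1K Ax); exact: PU.
Qed.

Lemma near_finite (T I : Type) (F : set_system T) (S : set I)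
    (P : I -> T -> Prop) : Filter F -> finite_set S ->
  (forall i, S i -> \forall t \near F, P i t) ->
  \forall t \near F, forall i, S i -> P i t.
Proof.
move=> FF; elim/finite_set_induction: S / => [_|i A IH h]; first exact: nearW.
have hi : \forall t \near F, P i t by apply: h; left.
have hA : \forall t \near F, forall j, A j -> P j t.
  by apply: IH => j Aj; apply: h; right.
by apply: filterS2 hi hA => t Pi PA j [->//|]; exact: PA.
Qed.

Lemma reciprocal_summable_bigcup (R : realType) (I : Type) (S : set I)
    (A : I -> set nat) : finite_set S ->
  (forall i, S i -> reciprocal_summable R (A i)) ->
  reciprocal_summable R (\bigcup_(i in S) A i).
Proof.
elim/finite_set_induction: S / => [_|i S IH h].
  by rewrite bigcup_set0; exact: reciprocal_summable0.
rewrite bigcup_setU1; apply: reciprocal_summableU; first by apply: h; left.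
by apply: IH => j Sj; apply: h; right.
Qed.

(* The vertices of the complete binary tree are numbered so that those of level
   [k] fill [2 ^ k, 2 ^ k.+1[; this makes every branch reciprocal-summable. *)
Fixpoint branch (f : nat -> bool) (k : nat) : nat :=
  if k is k'.+1 then (f k' + (branch f k').*2)%N else 1%N.

Lemma branch_ge f k : (2 ^ k <= branch f k)%N.
Proof.
elim: k => //= k IH; rewrite expnS mul2n.
by apply: leq_trans (leq_addl _ _); rewrite leq_double.
Qed.

Lemma leq_branch f k : (k <= branch f k)%N.
Proof. by apply: leq_trans (branch_ge f k); rewrite ltnW// ltn_expl. Qed.

Lemma branch_lt f k : (branch f k < 2 ^ k.+1)%N.
Proof.
elim: k => //= k IH; rewrite expnS mul2n.
have : ((branch f k).+1.*2 <= (2 ^ k.+1).*2)%N by rewrite leq_double.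
by apply: leq_trans; rewrite doubleS ltnS; case: (f k).
Qed.

(** The lowest binary digit of a vertex below the root is the last turn and the other digits give
    its parent, so the number determines the level and the path. *)
Lemma eq_branch f g k l : branch f k = branch g l ->
  k = l /\ forall j, (j < k)%N -> f j = g j.
Proof.
elim: k l => [|k IH] [|l] //=.
- move=> h; move: (branch_ge g l.+1) => /=; rewrite -h expnS.
  by case: (2 ^ l)%N (expn_gt0 2 l) => // -[].
- move=> h; move: (branch_ge f k.+1) => /=; rewrite h expnS.
  by case: (2 ^ k)%N (expn_gt0 2 k) => // -[].
move=> h; have fg : f k = g l.
  by move/(congr1 odd): h; rewrite !oddD !odd_double !addbF !oddb.
have /IH[kl fgk] : branch f k = branch g l.
  by move/(congr1 half): h; rewrite !half_bit_double.
subst l; split=> // j; rewrite ltnS leq_eqVlt => /orP[/eqP -> //|]; exact: fgk.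
Qed.

(** Once the paths differ at [j], no vertex of [f] beyond level [j] lies on [g]. *)
Lemma branch_almost_disjoint f g : f <> g ->
  \forall k \near \oo, forall l, branch f k <> branch g l.
Proof.
move=> fg; have [j fgj] : exists j, f j <> g j.
  apply: contrapT => h; apply: fg; apply/funext => j.
  by apply: contrapT => ?; apply: h; exists j.
by exists j.+1 => // k /= jk l /eq_branch[_ /(_ j jk)].
Qed.

Lemma near_branch f (P : nat -> Prop) : (\forall k \near \oo, P k) ->
  \forall n \near \oo, forall k, n = branch f k -> P k.
Proof.
(* As [branch f k < 2 ^ k.+1], a vertex numbered at least [2 ^ N.+1] has level at least [N]. *)
move=> [N _ NP]; exists (2 ^ N.+1)%N => // n /= nN k nk; apply: NP => /=.
have := leq_trans nN (leq_trans (eq_leq nk) (ltnW (branch_lt f k))).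
by rewrite leq_exp2l.
Qed.

Lemma summable_branch (R : realType) f :
  reciprocal_summable R (range (branch f)).
Proof.
by apply: reciprocal_summable_range => k; rewrite ltnW// ltnS branch_ge.
Qed.

(** * Isometric embedding of the direct sum modulo [c0] *)

Lemma isometric_copy (K : numFieldType) (A B : normedAlgType K) (f : B -> A) :
  (forall (k : K) x y, f (k *: x + y) = k *: f x + f y) ->
  (forall x y, f (x ** y) = f x ** f y) -> (forall x, `|f x| = `|x|) ->
  contains_isometric_copy A B.
Proof.
move=> fL fM fN.
have f0 : f 0 = 0 by rewrite -(addNr (0 : B)) -scaleN1r fL scaleN1r addNr.
have fD x y : f (x + y) = f x + f y by rewrite -[x]scale1r fL !scale1r.
have fZ k x : f (k *: x) = k *: f x by rewrite -[k *: x]addr0 fL f0 addr0.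
have fI : injective f.
  move=> x y fxy; apply/eqP; rewrite -subr_eq0 -normr_eq0 -fN fD -scaleN1r fZ.
  by rewrite scaleN1r fxy subrr normr0.
have sub : subalgebra (range f).
  split; first by exists 0.
  - by move=> _ _ [x _ <-] [y _ <-]; exists (x + y).
  - by move=> k _ [x _ <-]; exists (k *: x).
  - by move=> _ _ [x _ <-] [y _ <-]; exists (x ** y).
pose g x : subalg sub := Subalg (asboolT (imageT f x)).
exists (range f), sub, g; split=> //.
- pose h (a : subalg sub) := projT1 (cid2 (subalgP a)).
  have hK : cancel h g.
    by move=> a; apply: val_inj; rewrite /= /h; case: cid2.
  exists h => // x; apply: fI.
  exact: (congr1 (@subalg_val _ _ _ sub) (hK (g x))).
- by move=> k x y; apply: val_inj; exact: fL.
- by move=> x y; apply: val_inj; exact: fM.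
Qed.

Section AlmostDisjoint.
Variables (R : realType) (I : Type) (b : I -> nat -> bool).
Hypothesis b_inj : injective b.
Variable sub : subalgebra (@s0 R).
Local Notation C := R[i].
Local Notation linfty := (linfty R).
Local Notation c0_ideal := (c0_closed_ideal R).
Local Notation ind := (indic_seq R).
Local Notation Linf := (quot_alg c0_ideal).
Local Notation S0 := (quot_alg (closed_ideal_restrict sub c0_ideal)).
Local Notation D := (dsum (fun _ : I => Linf)).

Definition pull (f : nat -> bool) (z : linfty) : linfty :=
  bfun_of (normr_ge0 z) (fun k => bfun_norm_ub z (branch f k)).

Lemma pullE f z k : pull f z k = z (branch f k). Proof. by []. Qed.

Lemma norm_pull f z : `|pull f z| <= `|z|.
Proof. by apply: bfun_norm_le => // k; exact: (bfun_norm_ub z). Qed.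

Lemma pull_linear f k z w : pull f (k *: z + w) = k *: pull f z + pull f w.
Proof. by apply: bfun_ext. Qed.

Lemma pull_mul f z w : pull f (z ** w) = pull f z ** pull f w.
Proof. by apply: bfun_ext. Qed.

Definition branches (S : set I) : set nat :=
  \bigcup_(i in S) range (branch (b i)).

Lemma branchesS S S' : S `<=` S' -> branches S `<=` branches S'.
Proof. by move=> SS' n [i Si ni]; exists i => //; exact: SS'. Qed.

(** Tending to 0 off the branches is put as membership of a product in [c0], so that stability under
    sums and products follows from the ideal property. *)
Definition carried (z : linfty) (S : set I) := c0 (z ** ind (~` branches S)).

Lemma carriedS z S S' : S `<=` S' -> carried z S -> carried z S'.
Proof.
move=> SS'; rewrite /carried => zS.
have -> : ~` branches S' = ~` branches S `&` ~` branches S'.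
  by rewrite -setCU ((setUidPr _ _).2 (branchesS SS')).
rewrite indic_setI amulA; have [_ _ _ IM] := c0_ideal.1.
by have [_] := IM (ind (~` branches S')) _ zS.
Qed.

(* [z] represents [x] if it restricts along the [i]-th branch to a member of
   [x i] and tends to 0 off finitely many branches. *)
Definition represents (z : linfty) (x : D) :=
  [/\ s0 z, forall i, quot_proj c0_ideal (pull (b i) z) = x i &
      exists2 S, finite_set S & carried z S].

Lemma represents_linear k z w x y :
  represents z x -> represents w y -> represents (k *: z + w) (k *: x + y).
Proof.
move=> [sz zx [S fS zS]] [sw wy [S' fS' wS']].
have [_ ID IZ _] := (s0_closed_ideal R).1; have [_ JD JZ _] := c0_ideal.1.
split; first by apply: ID => //; exact: IZ.
  by move=> i; rewrite pull_linear quot_projD quot_projZ zx wy.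
exists (S `|` S'); first by rewrite finite_setU.
rewrite /carried amulDl -scale_amull; apply: JD; first apply: JZ.
  by apply: carriedS zS => ?; left.
by apply: carriedS wS' => ?; right.
Qed.

Lemma represents_mul z w x y :
  represents z x -> represents w y -> represents (z ** w) (x ** y).
Proof.
move=> [sz zx _] [sw wy [S fS wS]].
have [_ _ _ IM] := (s0_closed_ideal R).1; have [_ _ _ JM] := c0_ideal.1.
split; first by have [] := IM z w sw.
  by move=> i; rewrite pull_mul -quot_mulE zx wy.
exists S => //; rewrite /carried -amulA.
by have [] := JM z _ wS.
Qed.

Lemma c0_pull f z : c0 z -> c0 (pull f z).
Proof.
move=> /c0P cz; apply/c0P => d d0; have [N _ Nz] := cz _ d0.
exists N => // k Nk.
by apply: Nz; exact: leq_trans (leq_branch f k).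
Qed.

(** The entries of [z] tend to 0 along each of finitely many branches and also off them. By
    linearity, two representatives of one family thus differ by a member of [c0]. *)
Lemma represents0 z : s0 z -> represents z 0 <-> c0 z.
Proof.
move=> sz; split=> [[_ zx [S fS zS]]|cz]; last first.
  split=> //.
    move=> i; apply: etrans (quot_proj0 c0_ideal).
    by apply/quot_projP; rewrite subr0; exact: c0_pull.
  exists set0; first exact: finite_set0.
  have [_ _ _ JM] := c0_ideal.1.
  by have [_] := JM (ind (~` branches set0)) _ cz.
apply/c0P => d d0.
have h i : S i ->
    \forall n \near \oo, forall k, n = branch (b i) k -> `|z n| < d.
  move=> _; have /c0P/(_ _ d0) : c0 (pull (b i) z).
    rewrite -[pull _ _]subr0; apply/(quot_projP c0_ideal).
    by rewrite zx quot_proj0.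
  move=> /(near_branch (b i)); apply: filterS => n hn k nk.
  by have := hn _ nk; rewrite pullE -nk.
have /c0P/(_ _ d0) := zS; apply: filterS2 (near_finite _ fS h) => n hn.
rewrite !bfunE indic_seqE; case: ifPn => [_|/negP nS _]; first by rewrite mulr1.
have [i Si [k _ kn]] : branches S n.
  by apply: contrapT => h'; apply: nS; rewrite inE.
exact: (hn i Si k).
Qed.

Lemma represents_norm z x : represents z x -> `|x| <= `|z|.
Proof.
move=> [_ zx _]; apply: dsum_norm_le => // i; rewrite -zx.
exact: le_trans (quot_norm_le _ _) (norm_pull _ _).
Qed.

(** Nearly minimal lifts of the finitely many nonzero coordinates are written on their branches from
    a level [N] on, where these branches are disjoint; omitting lower levels changes nothing modulo
    [c0]. *)
Lemma represents_ex x (d : C) : 0 < d ->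
  exists2 z, represents z x & `|z| <= `|x| + d.
Proof.
move=> d0.
have /choice[r rP] : forall i, exists u : linfty,
    quot_proj c0_ideal u = x i /\ `|u| < `|x i| + d.
  by move=> i; have [u ux ud] := quot_norm_lt (x i) d0; exists u.
pose S := [set i | x i <> 0]; have fS : finite_set S := dsumP x.
(* Here [i] is any index: for [i] outside [S] this makes [z] vanish eventually along the [i]-th
   branch. *)
have dis i : \forall k \near \oo, forall j, S j -> i <> j ->
    forall l, branch (b i) k <> branch (b j) l.
  apply: near_finite => // j _.
  have [->|ij] := pselect (i = j); first exact: nearW.
  have bij : b i <> b j by move=> /b_inj.
  by apply: filterS (branch_almost_disjoint bij) => k ? _.
have [N _ HN] := near_finite _ fS (fun i _ => dis i).
pose Q n (ik : I * nat) :=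
  [/\ S ik.1, (N <= ik.2)%N & n = branch (b ik.1) ik.2].
(* A vertex of level at least [N] lies on at most one branch indexed by [S], so the chosen pair is
   the only one; all other vertices get 0. *)
pose f n : C^o := if pselect (exists ik, Q n ik) is left h
  then r (projT1 (cid h)).1 (projT1 (cid h)).2 else 0.
have fM n : `|f n| <= `|x| + d.
  rewrite /f; case: pselect => [h|_]; last first.
    by rewrite normr0 addr_ge0 ?normr_ge0// ltW.
  apply: le_trans (bfun_norm_ub _ _) _; apply: le_trans (ltW (rP _).2) _.
  by rewrite lerD2r; exact: (dsum_norm_ub x).
have M0 : 0 <= `|x| + d by rewrite addr_ge0 ?normr_ge0// ltW.
pose z : linfty := bfun_of M0 fM.
have zE i k : S i -> (N <= k)%N -> z (branch (b i) k) = r i k.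
  move=> Si Nk; rewrite /z /= /f.
  case: pselect => [h|[]]; last by exists (i, k).
  case: cid => -[j l] [/= Sj Nl jl].
  have kl : k = l by have [] := eq_branch jl.
  have [ij|ij] := pselect (i = j); first by rewrite -ij -kl.
  by case: (HN k Nk i Si j Sj ij l jl).
have z0 n : z n != 0 -> branches S n.
  rewrite /z /= /f; case: pselect => [[[i k] [/= Si _ nE]] _|]; last first.
    by rewrite eqxx.
  by exists i => //; exists k.
exists z; last exact: bfun_norm_le.
split.
- apply: (s0_supported (A := branches S)) => //.
  by apply: reciprocal_summable_bigcup => // i _; exact: summable_branch.
- move=> i; have [Si|nSi] := pselect (S i).
    rewrite -(rP i).1; apply/quot_projP/c0P => e e0; exists N => // k Nk.
    by rewrite !bfunE pullE zE// subrr normr0.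
  have -> : x i = 0 by apply: contrapT.
  apply: etrans (quot_proj0 c0_ideal); apply/quot_projP/c0P => e e0.
  apply: filterS (dis i) => k hk; rewrite subr0 pullE.
  suff -> : z (branch (b i) k) = 0 by rewrite normr0.
  apply/eqP; apply/negPn/negP => /z0[j Sj [l _ jl]].
  by apply: (hk j Sj _ l) => // ij; apply: nSi; rewrite ij.
- exists S => //; apply/c0P => e e0; apply: nearW => n.
  rewrite !bfunE indic_seqE; case: ifPn => [/set_mem nS|_]; last first.
    by rewrite mulr0 normr0.
  have -> : z n = 0 by apply/eqP; apply/negPn/negP => /z0.
  by rewrite mul0r normr0.
Qed.

(** By [Feq] the class [F x] consists exactly of the representatives of [x]. Hence [F] inherits
    linearity and multiplicativity from [represents], and its norm is the infimum of the norms of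
    representatives. *)
Lemma dsum_isometric_copy : contains_isometric_copy S0 D.
Proof.
have /choice[z zP] : forall x : D, exists z : linfty, represents z x.
  by move=> x; have [z ? _] := represents_ex x ltr01; exists z.
have sz x : s0 (z x) by have [] := zP x.
pose Z x : subalg sub := Subalg (asboolT (sz x)).
pose F x : S0 := quot_proj (closed_ideal_restrict sub c0_ideal) (Z x).
have Feq (a : subalg sub) x :
    represents (subalg_val a) x <-> quot_proj _ a = F x.
  split=> [ax|/quot_projP/= cax].
    apply/quot_projP => /=.
    have := represents_linear (-1) (zP x) ax.
    rewrite !scaleN1r addNr addrC.
    exact: (represents0 (subalgP (a - Z x))).1.
  have sza : s0 (subalg_val a - z x) by exact: (subalgP (a - Z x)).
  have := represents_linear 1 (zP x) ((represents0 sza).2 cax).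
  by rewrite !scale1r addr0 addrC subrK.
apply: (@isometric_copy _ _ _ F).
- move=> k x y; rewrite /F -quot_projZ -quot_projD; apply/esym/Feq.
  by apply: represents_linear; exact: zP.
- move=> x y; apply/esym; rewrite [LHS]quot_mulE; apply/Feq.
  by apply: represents_mul; exact: zP.
move=> x; apply/le_anti/andP; split.
  apply/ler_addgt0Pr => d d0; have [w wx wd] := represents_ex x d0.
  have sw : s0 w by case: wx.
  have /Feq <- : represents (subalg_val (Subalg (asboolT sw) : subalg sub)) x.
    by [].
  by apply: (le_trans (quot_norm_le _ _)); exact: wd.
apply/ler_addgt0Pr => d d0; have [a /Feq ax ad] := quot_norm_lt (F x) d0.
exact: le_trans (represents_norm ax) (ltW ad).
Qed.

End AlmostDisjoint.

Theorem theorem3p1p2 (R : realType) :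
  exists s0_ideal : closed_ideal (@s0 R),
  let s0_alg := subalg (ideal_subalgebra s0_ideal.1) in
  let s0_mod_c0 := quot_alg
    (closed_ideal_restrict (ideal_subalgebra s0_ideal.1) (c0_closed_ideal R)) in
  let linfty_mod_c0 := quot_alg (c0_closed_ideal R) in
  [/\ ~ unital s0_alg,
      @s00 R `<=` @s0 R /\ @s0 R `<=` closure (@s00 R),
      forall (B : topologicalType) (e : nat -> B), stone_cech e ->
        let Y := reciprocal_summable_closure R e in
        isometrically_isomorphic s0_alg (C0 R Y) /\
        [/\ homeomorphic Y (spectrum s0_alg),
            locally_compact [set: Y],
            ~ compact [set: Y],
            range e `<=` Y &
            dense [set y : Y | range e (set_val y)]] &
      forall I : Type, [set: I] #= [set: nat -> bool] ->
        contains_isometric_copy s0_mod_c0 (dsum (fun _ : I => linfty_mod_c0))].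
Proof.
exists (s0_closed_ideal R) => /=; split.
- exact: s0_non_unital.
- by split; [exact: s00_sub_s0|exact: s00_dense].
- move=> B e hB; split; first exact: gelfand_isomorphism.
  split.
  + exact: spectrum_homeomorphic.
  + exact: (locally_compact_summable hB).
  + exact: (noncompact_summable hB).
  + exact: (range_sub_summable R hB).
  + exact: (dense_nat_summable hB).
(* The bijection assigns to each index its own branch of the tree. *)
move=> I /card_set_bijP[b [_ b_inj _]].
have bI : injective b by move=> i j; apply: b_inj; rewrite inE.
exact: (dsum_isometric_copy bI).
Qed.
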